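(* There is a function $g:\mathbb{Z}_{\ge 1}\to[0,1]$ with $g(k)=O(\sqrt{\log k / k})$ as $k\to\infty$ such that the following holds. For every integer $k\ge 1$, every matroid $(E,\mathcal{F})$, and every prophet inequality instance $(E, \mathcal{F}^k, \{\mathcal{D}_e\}_{e \in E})$ where $(E,\mathcal{F}^k)$ is the $k$-fold union of $(E,\mathcal{F})$, there exists a $(1-g(k))$-competitive prophet inequality.
   Context: Given a matroid $(E,\mathcal{F})$ with finite ground set $E$ and family of independent sets $\mathcal{F}$, its $k$-fold union is the matroid $(E,\mathcal{F}^k)$ with $\mathcal{F}^k=\{F_1\cup\cdots\cup F_k : F_1,\dots,F_k\in\mathcal{F}\}$. A prophet inequality instance $(E,\mathcal{G},\{\mathcal{D}_e\}_{e\in E})$ consists of a ground set $E$, a downward-closed family $\mathcal{G}\subseteq 2^E$, and distributions $\mathcal{D}_e$ of nonnegative reals. Elements arrive one at a time in an adversarial order (the adversary may choose the next element adaptively, with full knowledge of all realized values and the algorithm's past decisions); upon arrival of $e$, $v_e\sim\mathcal{D}_e$ (independent across elements) is revealed and an online algorithm must irrevocably accept or reject $e$, keeping the accepted set $A\in\mathcal{G}$. A $c$-competitive prophet inequality is an online algorithm guaranteeing $\mathbb{E}[\sum_{e\in A}v_e]\ge c\cdot\mathbb{E}[\max_{S\in\mathcal{G}}\sum_{e\in S}v_e]$. *)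

(* Defs.v *)
From HB Require Import structures.
From mathcomp Require Import all_boot all_order all_algebra.
From mathcomp Require Import all_classical all_reals all_analysis.

Set Implicit Arguments.
Unset Strict Implicit.
Unset Printing Implicit Defensive.
Import Order.TTheory GRing.Theory Num.Theory.
Import numFieldNormedType.Exports.
Local Open Scope classical_set_scope.
Local Open Scope ring_scope.

Definition is_matroid (E : finType) (F : {set {set E}}) : Prop :=
  [/\ finset.set0 \in F,
      forall A B : {set E}, A \subset B -> B \in F -> A \in F
    & forall A B : {set E}, A \in F -> B \in F -> (#|A| < #|B|)%N ->
        exists2 e, e \in (B :\: A)%SET & (e |: A)%SET \in F].

Definition kfold_union (E : finType) (F : {set {set E}}) (k : nat) :
    {set {set E}} :=
  [set (\bigcup_(i < k) f i)%SET | f : {ffun 'I_k -> {set E}}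
                                 & [forall i, f i \in F]]%SET.

Definition mutually_independent (R : realType) (E : finType)
    (d : measure_display) (Om : measurableType d) (P : probability Om R)
    (v : E -> {RV P >-> R}) : Prop :=
  forall (J : {set E}) (B : E -> set R), (forall e, measurable (B e)) ->
    P [set w | forall e, e \in J -> B e (v e w)] =
    (\prod_(e in J) P (v e @^-1` B e))%E.

(* [decide s h e x] is the decision on [e], arriving with value [x], after the
   past [h] (arrived elements in order of arrival, each with its revealed value
   and the decision taken), when the internal randomness is [s]. *)
Record online_algorithm (R : realType) (E : finType) := OnlineAlgorithm {
  seed_display : measure_display ;
  seed : measurableType seed_display ;
  seed_law : probability seed R ;
  decide : seed -> seq (E * R * bool) -> E -> R -> bool }.

(* The next element, as a function of the full profile of realized values and
   of the past arrivals with their decisions. The adversary sees decisions but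
   not the seed of the algorithm. *)
Definition adversary (R : realType) (E : finType) : Type :=
  (E -> R) -> seq (E * bool) -> E.

Definition legal_adversary (R : realType) (E : finType)
    (adv : adversary R E) : Prop :=
  forall (x : E -> R) (h : seq (E * bool)),
    (exists e, e \notin unzip1 h) -> adv x h \notin unzip1 h.

Section Execution.
Variables (R : realType) (E : finType) (alg : online_algorithm R E).
Variables (adv : adversary R E) (x : E -> R) (s : seed alg).

Fixpoint execution (n : nat) : seq (E * bool) :=
  if n is m.+1 then
    let h := execution m in
    let e := adv x h in
    rcons h (e, decide s [seq (p.1, x p.1, p.2) | p <- h] e (x e))
  else [::].

(* Against a legal adversary, every element has arrived after #|E| steps. *)
Definition accepted : {set E} :=
  [set e | (e, true) \in execution #|E|]%SET.

End Execution.

Definition feasible_algorithm (R : realType) (E : finType) (G : {set {set E}})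
    (alg : online_algorithm R E) : Prop :=
  forall (adv : adversary R E) (x : E -> R) (s : seed alg),
    legal_adversary adv -> accepted adv x s \in G.

(* The default 0 of the maximum is the value of the empty set, which belongs
   to every nonempty downward-closed family. *)
Definition offline_optimum (R : realType) (E : finType) (G : {set {set E}})
    (x : E -> R) : R :=
  \big[Num.max/0]_(S in G) \sum_(e in S) x e.

(* The seed is independent of the values: the pair lives on P \x seed_law.
   Measurability of the adversary along [v], and of the events "e is accepted",
   is what makes the expected reward meaningful. Expectations are extended
   reals, since the D e need not have a finite mean. *)
Definition competitive (R : realType) (E : finType) (G : {set {set E}})
    (D : E -> probability R R) (c : R) (alg : online_algorithm R E) : Prop :=
  feasible_algorithm G alg /\
  forall (d : measure_display) (Om : measurableType d) (P : probability Om R)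
    (v : E -> {RV P >-> R}) (adv : adversary R E),
    mutually_independent v ->
    (forall e (B : set R), measurable B -> distribution P (v e) B = D e B) ->
    legal_adversary adv ->
    (forall h e, measurable [set w | adv (v^~ w) h = e]) ->
    (forall e, measurable
       [set ws : Om * seed alg | e \in accepted adv (v^~ ws.1) ws.2]) /\
    (c%:E * 'E_P[fun w => offline_optimum G (v^~ w)] <=
     'E_(P \x seed_law alg)[fun ws =>
        (\sum_(e in accepted adv (v^~ ws.1) ws.2) v e ws.1)%R])%E.

(* Main.v *)
(* Let [X e] be the probability that [e] lies in the offline optimum, and say
   that an element is spanned in F^j when adding it does not increase the rank
   of the j-fold union. Elements are put into levels; an active element is
   accepted unless it is spanned in F^k by all the elements of higher level
   together with the accepted elements of its own level. Whatever the order of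
   arrival, the accepted set is independent in F^k, and [e] is accepted if it is
   active and not spanned by the higher levels and the other active elements of
   its level.

   The number of j <= k such that [e] is spanned in F^j is monotone and
   1-Lipschitz in the active set, since removing an element costs at most one of
   the j independent sets. For a monotone 1-Lipschitz f and densities q <= u p,
   E_p[u^f] E_q[u^-f] <= 1: this is checked on one coordinate and tensorizes.
   Hence, as soon as [e] is unspanned in F^k' (with k' slightly below k) with
   non-negligible probability at density p, it is unspanned in F^k with high
   probability at density u p. A potential argument on expected ranks shows that
   p = c X leaves in every set of non-loops such a nonempty top level.

   Activity is a threshold test on the value of [e], which collects at least the
   share of [e] in the optimum with the prescribed probability. Randomization is
   only needed at the thresholds, and as the guarantee is affine in each bias it
   can be removed. *)
Require Import Defs.
From HB Require Import structures.
From mathcomp Require Import all_boot all_order all_algebra.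
From mathcomp Require Import zify ring lra.

Set Implicit Arguments.
Unset Strict Implicit.
Unset Printing Implicit Defensive.
Import Order.TTheory GRing.Theory Num.Theory.

(** * Rank and span *)

Definition rank (E : finType) (N : {set {set E}}) (X : {set E}) : nat :=
  \max_(A in N | A \subset X) #|A|.

Definition spans (E : finType) (N : {set {set E}}) (X : {set E}) (e : E) :=
  rank N (e |: X) == rank N X.

Section Rank.
Variables (E : finType) (N : {set {set E}}).
Hypothesis mN : is_matroid N.
Implicit Types (A B X Y : {set E}) (e : E).

Let N0 : set0 \in N. Proof. by case: mN. Qed.
Let NS A B : A \subset B -> B \in N -> A \in N. Proof. by case: mN => _ + _; apply. Qed.

Lemma indep_rank_ge A X : A \in N -> A \subset X -> #|A| <= rank N X.
Proof. by move=> AN AX; rewrite /rank (bigop.bigmax_sup A) // AN. Qed.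

Lemma rank_basis X : exists A, [/\ A \in N, A \subset X & #|A| = rank N X].
Proof.
have P0 : (set0 \in N) && (set0 \subset X) by rewrite N0 sub0set.
rewrite /rank (bigop.bigmax_eq_arg set0 (P := fun A => (A \in N) && (A \subset X)) P0).
by case: arg_maxnP => // A /andP[AN AX] _; exists A.
Qed.

Lemma rankS X Y : X \subset Y -> rank N X <= rank N Y.
Proof.
move=> XY; have [A [AN AX <-]] := rank_basis X.
by apply: indep_rank_ge => //; apply: subset_trans AX XY.
Qed.

Lemma rank_le_card X : rank N X <= #|X|.
Proof. by have [A [_ AX <-]] := rank_basis X; apply: subset_leq_card. Qed.

Lemma indep_rank X : (X \in N) = (rank N X == #|X|).
Proof.
apply/idP/eqP => [XN|rX].
  by apply/eqP; rewrite eqn_leq rank_le_card indep_rank_ge.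
have [A [AN AX cA]] := rank_basis X.
suff -> : X = A by [].
by apply/eqP; rewrite eq_sym eqEcard AX cA rX /=.
Qed.

Lemma extend_basis A X : A \in N -> A \subset X ->
  exists B, [/\ A \subset B, B \in N, B \subset X & #|B| = rank N X].
Proof.
have [n] := ubnP (rank N X - #|A|).
elim: n A => // n IH A lt AN AX.
have := indep_rank_ge AN AX; rewrite leq_eqVlt => /predU1P[<-|ltA].
  by exists A; split.
have [C [CN CX cC]] := rank_basis X.
case: mN => _ _ /(_ A C AN CN); rewrite cC => /(_ ltA)[e].
rewrite inE => /andP[eA eC] eAN.
have eAX : e |: A \subset X by rewrite subUset sub1set (subsetP CX).
have [|B [eAB BN BX cB]] := IH _ _ eAN eAX; last first.
  by exists B; split=> //; apply: subset_trans (subsetUr _ _) eAB.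
by rewrite cardsU1 eA; move: lt ltA; lia.
Qed.

(** A basis of [X :&: Y] extends to a basis [B] of [X :|: Y]; then [B :&: X] and [B :&: Y] are
    independent, and their intersection contains the first basis. *)
Lemma rank_submod X Y :
  rank N (X :|: Y) + rank N (X :&: Y) <= rank N X + rank N Y.
Proof.
have [I [IN IXY <-]] := rank_basis (X :&: Y).
have IU : I \subset X :|: Y.
  by apply: subset_trans IXY _; apply: subset_trans (subsetIl _ _) (subsetUl _ _).
have [B [IB BN BU <-]] := extend_basis IN IU.
have hX : #|B :&: X| <= rank N X.
  by apply: indep_rank_ge (subsetIr _ _); apply: NS BN; apply: subsetIl.
have hY : #|B :&: Y| <= rank N Y.
  by apply: indep_rank_ge (subsetIr _ _); apply: NS BN; apply: subsetIl.
apply: leq_trans (leq_add hX hY); rewrite -[X in _ <= X]cardsUI -setIUr (setIidPl BU) leq_add2l.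
apply: subset_leq_card; rewrite setIACA setIid subsetI IB //.
Qed.

Lemma rankU1 X e : rank N (e |: X) <= (rank N X).+1.
Proof.
have h := rank_submod [set e] X.
apply: leq_trans (leq_addr _ _) _; apply: leq_trans h _.
by rewrite -add1n leq_add2r -(cards1 e) rank_le_card.
Qed.

Lemma rankU1_spans X e : rank N (e |: X) = ~~ spans N X e + rank N X.
Proof.
rewrite /spans; case: eqP => //= /eqP ne; apply/eqP.
by rewrite eqn_leq rankU1 ltn_neqAle eq_sym ne rankS // subsetUr.
Qed.

Lemma spansS X Y e : X \subset Y -> spans N X e -> spans N Y e.
Proof.
move=> XY /eqP sX; rewrite /spans eqn_leq (rankS (subsetUr _ _)) andbT.
have := rank_submod (e |: X) Y; rewrite -setUA (setUidPr XY) sX.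
have : rank N X <= rank N ((e |: X) :&: Y).
  by apply: rankS; rewrite subsetI XY subsetUr.
move=> h1 h2; rewrite -(leq_add2l (rank N X)); apply: leq_trans h2.
by rewrite addnC leq_add2l.
Qed.

(** Certificate form of spanning. In a union of matroids the certificate carries a coloring, which
    can be cut down class by class; this is how spans in different unions are compared. For [e] in
    [X] a certificate may fail to exist although [e] is spanned. *)
Lemma spansP X e : e \notin X ->
  reflect (exists A, [/\ A \subset X, A \in N & e |: A \notin N]) (spans N X e).
Proof.
move=> eX; apply: (iffP idP) => [/eqP sX|[A [AX AN eAN]]].
  have [A [AN AX cA]] := rank_basis X.
  exists A; split=> //; apply/negP => eAN.
  have := indep_rank_ge eAN (setUS _ AX).
  by rewrite sX -cA cardsU1 (contra (subsetP AX e) eX) ltnn.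
rewrite /spans eqn_leq (rankS (subsetUr _ _)) andbT.
have AeX : A \subset e |: X by apply: subset_trans AX (subsetUr _ _).
have [B [AB BN BX <-]] := extend_basis AN AeX.
apply: indep_rank_ge => //; apply/subsetP => f fB.
have /setU1P[fe|//] := subsetP BX f fB.
case/negP: eAN; apply: NS BN; rewrite subUset AB sub1set andbT -fe //.
Qed.

(* The rank hypothesis says that [Z] is independent in the contraction by [S]. *)
Lemma rank_contract (I S Z : {set E}) : I \subset S -> [disjoint S & Z] -> I \in N ->
  rank N (S :|: Z) = rank N S + #|Z| -> I :|: Z \in N.
Proof.
move=> IS dSZ IN rSZ; rewrite indep_rank eqn_leq rank_le_card /=.
have := rank_submod S (I :|: Z).
rewrite setUA (setUidPl IS) rSZ setIUr (setIidPr IS).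
move: dSZ; rewrite -setI_eq0 => /eqP ->; rewrite setU0.
move: IN; rewrite indep_rank => /eqP ->.
rewrite -addnA leq_add2l => h; apply: leq_trans h.
by rewrite cardsU addnC leq_subr.
Qed.

End Rank.

(** * Unions of matroids *)

Section Union.
Variables (E : finType) (F : {set {set E}}).
Hypothesis mF : is_matroid F.
Implicit Types (A B X Y : {set E}) (e : E).

Let F0 : set0 \in F. Proof. by case: mF. Qed.
Let FS A B : A \subset B -> B \in F -> A \in F. Proof. by case: mF => _ + _; apply. Qed.

(** Colours are plain natural numbers, so that classes can be renamed while [k] varies. The first
    clause makes all classes [i >= k] empty. *)
Definition coloring (k : nat) A (c : E -> nat) :=
  (forall e, e \in A -> c e < k) /\ (forall i, [set e in A | c e == i] \in F).

(** A cover by [k] independent sets becomes a partition once each element keeps a single set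
    containing it, because [F] is downward closed. *)
Lemma kfold_unionP k A : A \in kfold_union F k <-> exists c, coloring k A c.
Proof.
split=> [/imsetP[f]|[c [ck cF]]].
  rewrite inE => /forallP fF ->.
  exists (fun e => if [pick i | e \in f i] is Some i then val i else 0); split.
    move=> e /bigcupP[i _ ei]; case: pickP => [j _|/(_ i)]; first exact: ltn_ord.
    by rewrite ei.
  move=> i; have [lt|le] := ltnP i k.
    apply: FS (fF (Ordinal lt)); apply/subsetP => e; rewrite inE => /andP[/bigcupP[j _ ej]].
    case: pickP => [l el /eqP li|/(_ j)]; last by rewrite ej.
    by rewrite -(_ : l = Ordinal lt) //; apply: val_inj.
  rewrite (_ : [set _ | _ & _] = set0) //; apply/setP => e; rewrite !inE.
  apply/negP => /andP[/bigcupP[j _ ej]]; case: pickP => [l _ /eqP li|/(_ j)].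
    by have := ltn_ord l; rewrite li ltnNge le.
  by rewrite ej.
apply/imsetP; exists [ffun i : 'I_k => [set e in A | c e == i]].
  by rewrite inE; apply/forallP => i; rewrite ffunE.
apply/setP => e; apply/idP/bigcupP => [eA|[i _]]; last by rewrite ffunE inE => /andP[].
by exists (Ordinal (ck e eA)) => //; rewrite ffunE inE eA /=.
Qed.

Lemma card_coloring k A c : coloring k A c ->
  #|A| = \sum_(i < k) #|[set e in A | c e == i]|.
Proof.
move=> [ck _]; rewrite -sum1_card.
under [RHS]eq_bigr do rewrite -sum1_card big_mkcond.
rewrite exchange_big big_mkcond /=; apply: eq_bigr => e _.
case: ifPn => [eA|eA]; last first.
  by rewrite big1 // => i _; rewrite inE (negPf eA).
rewrite (bigD1 (Ordinal (ck e eA))) //= inE eA eqxx /= big1 // => i ni.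
rewrite inE eA; case: eqP => //= ci; case/eqP: ni; exact: val_inj.
Qed.

Lemma kfold_union_matroid k : is_matroid (kfold_union F k).
Proof.
split.
- apply/kfold_unionP; exists (fun=> 0); split=> [e|i]; first by rewrite inE.
  by rewrite (_ : [set _ | _ & _] = set0) //; apply/setP => e; rewrite !inE.
- move=> A B AB /kfold_unionP[c [ck cF]]; apply/kfold_unionP; exists c; split.
    by move=> e eA; apply: ck; apply: (subsetP AB).
  by move=> i; apply: FS (cF i); apply/subsetP => e; rewrite !inE => /andP[/(subsetP AB)-> ->].
move=> A B /kfold_unionP[c cA] /kfold_unionP[d dB] ltAB.
(* Recolouring an element of [A] with its colour in [B] brings the two
   colourings closer, until some colour class of [A] can be enlarged. *)
have [n] := ubnP #|[set e in A :&: B | c e != d e]|.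
elim: n c cA => // n IH c cA; rewrite ltnS => le.
have [i lti] : exists i : 'I_k,
    #|[set e in A | c e == i]| < #|[set e in B | d e == i]|.
  apply/existsP; apply: contraLR ltAB; rewrite negb_exists => /forallP h.
  rewrite -leqNgt (card_coloring cA) (card_coloring dB); apply: leq_sum => i _.
  by rewrite leqNgt h.
have [ck cF] := cA; have [dk dF] := dB.
case: mF => _ _ /(_ _ _ (cF i) (dF i) lti)[e]; rewrite !inE.
move=> /andP[eAi /andP[eB /eqP dei]] eF.
pose c' f := if f == e then i : nat else c f.
have c'A : coloring k (e |: A) c'.
  split=> [f|j].
    by rewrite !inE /c'; case: (eqVneq f e) => //= _; apply: ck.
  have [ji|ji] := eqVneq j i.
    apply: FS eF; apply/subsetP => f; rewrite !inE /c' ji.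
    by case: (eqVneq f e).
  apply: FS (cF j); apply/subsetP => f; rewrite !inE /c'; case: (eqVneq f e) => //= _.
  by rewrite eq_sym (negPf ji).
have [eA|eA] := boolP (e \in A); last first.
  by exists e; [rewrite inE eA | apply/kfold_unionP; exists c'].
have eAA : e |: A = A by apply/setUidPr; rewrite sub1set.
rewrite eAA in c'A.
apply: (IH c') => //; apply: leq_trans le; apply: proper_card.
apply/properP; split; last first.
  exists e; first by rewrite !inE eA eB /= dei; move: eAi; rewrite eA.
  by rewrite !inE /c' eqxx dei eqxx andbF.
apply/subsetP => f; rewrite !inE /c'; case: (eqVneq f e) => [->|//].
by rewrite dei eqxx andbF.
Qed.

(** The last colour [j] takes over the name [i] of the deleted class, so the remaining colours are
    again those below [j]. *)
Lemma drop_color j A c i : coloring j.+1 A c -> i <= j ->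
  [set e in A | c e != i] \in kfold_union F j.
Proof.
move=> [ck cF] ij; apply/kfold_unionP.
exists (fun e => if c e == j then i else c e); split=> [e|l].
  rewrite inE => /andP[/ck ce cei]; case: eqP => [cej|/eqP cej].
    by move: ij; rewrite leq_eqVlt -cej eq_sym (negPf cei).
  by rewrite ltn_neqAle cej.
have [li|li] := eqVneq l i.
  apply: FS (cF j); apply/subsetP => e; rewrite !inE => /andP[/andP[-> ci]] /=.
  by case: (eqVneq (c e) j) => // _; rewrite li (negPf ci).
apply: FS (cF l); apply/subsetP => e; rewrite !inE => /andP[/andP[-> ci]] /=.
by case: (eqVneq (c e) j) => // _; rewrite eq_sym (negPf li).
Qed.

Lemma kfold_unionU j A I : A \in kfold_union F j -> I \in F ->
  A :|: I \in kfold_union F j.+1.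
Proof.
move=> /kfold_unionP[c [ck cF]] IF; apply/kfold_unionP.
exists (fun e => if e \in A then c e else j); split=> [e|l].
  by rewrite inE; case: ifPn => //= eA _; rewrite ltnS ltnW // ck.
have [lj|lj] := eqVneq l j.
  apply: FS IF; apply/subsetP => e; rewrite !inE lj.
  case: ifPn => //= [eA /eqP ce|_ /andP[]//].
  by have := ck _ eA; rewrite ce ltnn.
apply: FS (cF l); apply/subsetP => e; rewrite !inE.
by case: ifPn => //= eA /andP[_]; rewrite eq_sym (negPf lj).
Qed.

(** This is the source of the Lipschitz property. Delete from a certificate the colour class of [a].
    If [e] could be added to what remains, putting the class back would color [e |: A] with [j.+1]
    colours. *)
Lemma spans_kfold_setD1 j Y e a : e \notin Y ->
  spans (kfold_union F j.+1) Y e -> spans (kfold_union F j) (Y :\ a) e.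
Proof.
move=> eY /(spansP (kfold_union_matroid _) eY)[A [AY AN eAN]].
apply/(spansP (kfold_union_matroid _)); first by rewrite !inE negb_and eY orbT.
have /kfold_unionP[c cA] := AN.
(* If [a] is outside the certificate any class may go; the last one is taken. *)
pose i := if a \in A then c a else j.
have ij : i <= j by rewrite /i; case: ifP => // /(proj1 cA).
exists [set e in A | c e != i]; split.
- apply/subsetP => f; rewrite !inE => /andP[fA ci]; rewrite (subsetP AY) // andbT.
  by apply: contraNneq ci => fa; rewrite /i -fa fA.
- exact: drop_color cA ij.
apply: contraNN eAN => h; have := kfold_unionU h (proj2 cA i).
suff -> : (e |: [set e0 in A | c e0 != i]) :|: [set e0 in A | c e0 == i] = e |: A by [].
apply/setP => f; rewrite !inE.
by case: (f == e) => //=; case: (f \in A) => //=; case: eqP.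
Qed.

(** Each step down removes an element that is not there: the previous lemma is used with
    [a := e]. *)
Lemma spans_kfold_decr i j Y e : e \notin Y -> i <= j ->
  spans (kfold_union F j) Y e -> spans (kfold_union F i) Y e.
Proof.
move=> eY; elim: j => [|j IH]; first by rewrite leqn0 => /eqP->.
rewrite leq_eqVlt => /predU1P[->//|]; rewrite ltnS => ij h; apply: IH => //.
have := spans_kfold_setD1 e eY h; rewrite (_ : Y :\ e = Y) //.
by apply/setDidPl; rewrite disjoint_sym disjoints1.
Qed.

(** The smallest of the [j.+1] classes of a basis holds at most a fraction 1/(j+1) of it, and
    without that class the basis is independent in the [j]-fold union. *)
Lemma rank_kfoldS j X :
  j * rank (kfold_union F j.+1) X <= j.+1 * rank (kfold_union F j) X.
Proof.
have [A [/kfold_unionP[c cA] AX <-]] := rank_basis (kfold_union_matroid j.+1) X.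
have [i hi] : exists i : 'I_j.+1, j.+1 * #|[set e in A | c e == i]| <= #|A|.
  apply/existsP; case: existsP => // nh.
  have h (i : 'I_j.+1) : ~~ (j.+1 * #|[set e in A | c e == i]| <= #|A|).
    by apply/negP => hi; apply: nh; exists i.
  have : \sum_(i < j.+1) #|A| < \sum_(i < j.+1) j.+1 * #|[set e in A | c e == i]|.
    rewrite !big_ord_recr /= -addnS leq_add //; last by rewrite ltnNge; apply: (h ord_max).
    by apply: leq_sum => i _; rewrite ltnW // ltnNge; apply: (h (widen_ord _ i)).
  by rewrite -big_distrr -(card_coloring cA) sum_nat_const card_ord ltnn.
have h : #|[set e in A | c e != i]| <= rank (kfold_union F j) X.
  apply: indep_rank_ge; first exact: drop_color cA (ltn_ord i).
  by apply/subsetP => e; rewrite inE => /andP[/(subsetP AX)].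
have cAi : #|A| = #|[set e in A | c e == i]| + #|[set e in A | c e != i]|.
  by rewrite -(cardsID [set e | c e == i] A); congr (_ + _); apply: eq_card => e;
    rewrite !inE // andbC.
by move: hi; rewrite cAi; nia.
Qed.

Lemma rank_kfold_le i j X : i <= j ->
  i * rank (kfold_union F j) X <= j * rank (kfold_union F i) X.
Proof.
elim: j => [|j IH]; first by rewrite leqn0 => /eqP->.
rewrite leq_eqVlt => /predU1P[->//|]; rewrite ltnS => ij.
have [j0|j0] := posnP j; first by move: ij; rewrite j0 leqn0 => /eqP->.
rewrite -(leq_pmul2l j0) mulnCA.
apply: leq_trans (leq_mul (leqnn i) (rank_kfoldS j X)) _.
by rewrite mulnCA [j * _]mulnCA leq_mul2l IH ?orbT.
Qed.

End Union.

(** * Random subsets and concentration *)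

Local Open Scope ring_scope.

Section RandomSubset.
Variables (R : realFieldType) (E : finType).
Implicit Types (p q : E -> R) (s : seq E) (A B : {set E}) (phi psi : {set E} -> R).

(* The expectation of [phi (A :|: B)], where [B] contains each [e] of [s]
   independently with probability [p e]. *)
Fixpoint Ex p s phi A : R :=
  if s is e :: s' then p e * Ex p s' phi (e |: A) + (1 - p e) * Ex p s' phi A
  else phi A.

Definition prob p := forall e, 0 <= p e <= 1.

Lemma eq_Ex p q s phi psi A : {in s, p =1 q} -> phi =1 psi ->
  Ex p s phi A = Ex q s psi A.
Proof.
move=> pq eq; elim: s A pq => [|e s IH] A pq /=; first exact: eq.
by rewrite pq ?mem_head // !IH // => f fs; apply: pq; rewrite inE fs orbT.
Qed.

Lemma Ex_cst p s c A : Ex p s (fun=> c) A = c.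
Proof. by elim: s A => //= e s IH A; rewrite !IH; ring. Qed.

Lemma ExZ p s c phi A : Ex p s (fun B => c * phi B) A = c * Ex p s phi A.
Proof. by elim: s A => //= e s IH A; rewrite !IH; ring. Qed.

Lemma ExB p s phi psi A :
  Ex p s (fun B => phi B - psi B) A = Ex p s phi A - Ex p s psi A.
Proof. by elim: s A => //= e s IH A; rewrite !IH; ring. Qed.

Lemma Ex_sum (I : finType) (P : pred I) p s (phi : I -> {set E} -> R) A :
  Ex p s (fun B => \sum_(i | P i) phi i B) A = \sum_(i | P i) Ex p s (phi i) A.
Proof.
elim: s A => //= e s IH A; rewrite !IH !big_distrr -big_split.
by apply: eq_bigr.
Qed.

Lemma le_Ex p s phi psi A : prob p -> (forall B, phi B <= psi B) ->
  Ex p s phi A <= Ex p s psi A.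
Proof.
move=> hp le; elim: s A => //= e s IH A; have /andP[p0 p1] := hp e.
by rewrite lerD // ler_wpM2l // subr_ge0.
Qed.

Lemma Ex_setU1 p s phi e A : Ex p s phi (e |: A) = Ex p s (fun B => phi (e |: B)) A.
Proof. by elim: s A => //= f s IH A; rewrite -!IH setUCA. Qed.

Lemma Ex_filter p s phi e A : (forall B, phi (e |: B) = phi B) ->
  Ex p s phi A = Ex p (filter (predC1 e) s) phi A.
Proof.
move=> eq; elim: s A => //= f s IH A; case: eqVneq => [->|_] /=; last by rewrite !IH.
by rewrite Ex_setU1 (@eq_Ex p p _ _ phi) // IH; ring.
Qed.

Lemma Ex_mem p s e : prob p -> uniq s -> Ex p s (fun B => (e \in B)%:R) set0 <= p e.
Proof.
move=> hp; have /andP[p0 p1] := hp e.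
have : e \notin (set0 : {set E}) by rewrite inE.
elim: s set0 => [|f s IH] A eA /=; first by rewrite (negPf eA).
move=> /andP[fs us]; have /andP[q0 q1] := hp f; have [fe|fe] := eqVneq f e.
  have h1 : Ex p s (fun B => (e \in B)%:R) (f |: A) <= 1.
    rewrite -[X in _ <= X](Ex_cst p s 1 (f |: A)); apply: le_Ex => // B.
    by case: (_ \in _); rewrite ?lexx ?ler01.
  have -> : Ex p s (fun B => (e \in B)%:R) A = 0.
    move: eA fs; rewrite -fe; clear; elim: s A => [|g s IH] A eA /=.
      by rewrite (negPf eA).
    rewrite inE negb_or => /andP[fg fs]; rewrite !IH //; first by ring.
    by rewrite !inE negb_or fg.
  by move: h1; rewrite mulr0 addr0 fe => h1; rewrite ler_piMr.
have eA' : e \notin f |: A by rewrite !inE negb_or eq_sym fe.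
have := IH _ eA us; have := IH _ eA' us; nra.
Qed.

(** The expectation is affine in each single probability, as [uniq s] makes the coordinate [f] enter
    at most once. *)
Lemma Ex_affine p p0 p1 s phi A f t : uniq s ->
  (forall e, e != f -> p e = p0 e /\ p e = p1 e) ->
  p f = (1 - t) * p0 f + t * p1 f ->
  Ex p s phi A = (1 - t) * Ex p0 s phi A + t * Ex p1 s phi A.
Proof.
move=> + eqp eqf; elim: s A => [|e s IH] A /=; first by move=> _; ring.
move=> /andP[es us]; have [ef|ef] := eqVneq e f; last first.
  by rewrite !IH //; have [<- <-] := eqp e ef; ring.
have neq g : g \in s -> g != f by apply: contraTneq => ->; rewrite -ef.
have E0 B : Ex p0 s phi B = Ex p s phi B.
  by apply: eq_Ex => // g /neq/eqp[].
have E1 B : Ex p1 s phi B = Ex p s phi B.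
  by apply: eq_Ex => // g /neq/eqp[].
by rewrite !E0 !E1 ef eqf; ring.
Qed.

(** The one-coordinate case: index 1 or 0 tells whether the coordinate is in the set, [A] stands for
    the moment of u^f and [B] for that of u^-f. The cross terms [m = A1 * B0] and [M = A0 * B1]
    satisfy [M * m <= 1], hence [M - 1 <= M * (1 - m)]; and [q * M <= p], because
    [u * M <= A0 * B0 <= 1]. So the possible excess of [M] over 1 is paid for by the deficit of
    [m]. *)
Lemma two_point (p q u A0 A1 B0 B1 : R) : 0 <= q -> q <= u * p -> p <= 1 ->
  0 < u <= 1 -> 0 <= A0 -> 0 <= A1 <= A0 -> 0 <= B0 -> B0 <= B1 -> u * B1 <= B0 ->
  A0 * B0 <= 1 -> A1 * B1 <= 1 ->
  (p * A1 + (1 - p) * A0) * (q * B1 + (1 - q) * B0) <= 1.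
Proof.
move=> q0 qup p1 /andP[u0 u1] A00 /andP[A10 A1A0] B00 B01 uB AB0 AB1.
have p0 : 0 <= p by rewrite -(pmulr_rge0 _ u0) (le_trans q0).
have qp : q <= p by apply: le_trans qup _; rewrite ler_piMl.
set m := A1 * B0; set M := A0 * B1.
have m0 : 0 <= m by apply: mulr_ge0.
have m1 : m <= 1 by apply: le_trans AB0; apply: ler_wpM2r.
have Mm : M * m <= 1.
  have -> : M * m = (A0 * B0) * (A1 * B1) by rewrite /M /m; ring.
  by apply: mulr_ile1 => //; apply: mulr_ge0 => //; apply: le_trans B01.
have uM : u * M <= 1.
  by apply: le_trans AB0; rewrite /M mulrCA ler_wpM2l.
have M0 : 0 <= M by apply: mulr_ge0 => //; apply: le_trans B01.
have qM : q * M <= p.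
  apply: le_trans (ler_wpM2r M0 qup) _; rewrite mulrAC; apply: ler_piMl => //.
suff key : (1 - p) * q * (M - 1) <= p * (1 - q) * (1 - m).
  have -> : (p * A1 + (1 - p) * A0) * (q * B1 + (1 - q) * B0) =
    p * q * (A1 * B1) + (1 - p) * (1 - q) * (A0 * B0) +
    (p * (1 - q) * m + (1 - p) * q * M) by rewrite /m /M; ring.
  have h1 : p * q * (A1 * B1) <= p * q by apply: ler_piMr => //; apply: mulr_ge0.
  have h2 : (1 - p) * (1 - q) * (A0 * B0) <= (1 - p) * (1 - q).
    by apply: ler_piMr => //; apply: mulr_ge0; lra.
  lra.
apply: (@le_trans _ _ ((1 - p) * q * (M * (1 - m)))).
  by apply: ler_wpM2l; [apply: mulr_ge0; lra | lra].
have -> : (1 - p) * q * (M * (1 - m)) = (1 - p) * (q * M) * (1 - m) by ring.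
apply: ler_wpM2r; first lra.
rewrite mulrC; apply: ler_pM => //; [exact: mulr_ge0|lra|lra].
Qed.

(* Bicriterion concentration: [f] need not be self-bounding, because the second
   moment generating function is taken at a lower density. *)
Lemma Ex_bicriterion (u : R) p q s (f : {set E} -> nat) A :
  0 < u <= 1 -> prob p -> (forall e, 0 <= q e <= u * p e) ->
  (forall B e, (f B <= f (e |: B) <= (f B).+1)%N) ->
  Ex p s (fun B => u ^+ f B) A * Ex q s (fun B => u ^- f B) A <= 1.
Proof.
move=> /[dup] u01 /andP[u0 u1] hp hq hf.
have hq' : prob q.
  move=> e; have /andP[-> h] := hq e; have /andP[p0 p1] := hp e.
  by rewrite (le_trans h) // mulr_ile1 // ltW.
have un0 : u != 0 by rewrite gt_eqF.
elim: s A => [|e s IH] A /=.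
  by rewrite mulfV // expf_neq0.
have /andP[q0 qup] := hq e; have /andP[p0 p1] := hp e.
have mono n m : (n <= m)%N -> u ^+ m <= u ^+ n by move=> ?; apply: ler_wiXn2l => //; apply: ltW.
have pge0 B : 0 <= Ex p s (fun B => u ^+ f B) B.
  by rewrite -(Ex_cst p s 0 B); apply: le_Ex => // C; rewrite exprn_ge0 ?ltW.
have qge0 B : 0 <= Ex q s (fun B => u ^- f B) B.
  by rewrite -(Ex_cst q s 0 B); apply: le_Ex => // C; rewrite invr_ge0 exprn_ge0 ?ltW.
apply: (two_point (u := u)) (IH A) (IH (e |: A)) => //.
- rewrite pge0 Ex_setU1; apply: le_Ex => // B; apply: mono.
  by have /andP[] := hf B e.
- rewrite Ex_setU1; apply: le_Ex => // B; rewrite lef_pV2 ?posrE ?exprn_gt0 //.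
  by apply: mono; have /andP[] := hf B e.
- rewrite Ex_setU1 -ExZ; apply: le_Ex => // B.
  rewrite -[u in u * _]invrK -invfM lef_pV2 ?posrE ?exprn_gt0 //; last first.
    by rewrite mulr_gt0 ?invr_gt0 ?exprn_gt0.
  rewrite -(ler_pM2l u0) mulVKf // -exprS; apply: mono.
  by have /andP[] := hf B e.
Qed.

Lemma Ex_ge0 p s phi A : prob p -> (forall B, 0 <= phi B) -> 0 <= Ex p s phi A.
Proof. by move=> hp h; rewrite -(Ex_cst p s 0 A); apply: le_Ex. Qed.

(** Markov's inequality for both moments. The product form says that a lower tail at density [p]
    that is not small forces a small upper tail at density [q]. *)
Lemma Ex_tail (u : R) p q s (f : {set E} -> nat) A (i j : nat) :
  0 < u <= 1 -> prob p -> (forall e, 0 <= q e <= u * p e) ->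
  (forall B e, (f B <= f (e |: B) <= (f B).+1)%N) -> (i <= j)%N ->
  Ex p s (fun B => (f B <= i)%N%:R) A * Ex q s (fun B => (j <= f B)%N%:R) A
    <= u ^+ (j - i).
Proof.
move=> /[dup] u01 /andP[u0 u1] hp hq hf ij.
have hq' : prob q.
  move=> e; have /andP[-> h] := hq e; have /andP[p0 p1] := hp e.
  by rewrite (le_trans h) // mulr_ile1 // ltW.
have mono n m : (n <= m)%N -> u ^+ m <= u ^+ n by move=> ?; apply: ler_wiXn2l => //; apply: ltW.
have h1 : u ^+ i * Ex p s (fun B => (f B <= i)%N%:R) A <= Ex p s (fun B => u ^+ f B) A.
  rewrite -ExZ; apply: le_Ex => // B; case: leqP => [h|_] /=; rewrite ?mulr1 ?mulr0.
    exact: mono.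
  by rewrite exprn_ge0 ?ltW.
have h2 : u ^- j * Ex q s (fun B => (j <= f B)%N%:R) A <= Ex q s (fun B => u ^- f B) A.
  rewrite -ExZ; apply: le_Ex => // B; case: leqP => [h|_] /=; rewrite ?mulr1 ?mulr0.
    by rewrite lef_pV2 ?posrE ?exprn_gt0 // mono.
  by rewrite invr_ge0 exprn_ge0 ?ltW.
have uj : u ^+ j = u ^+ (j - i) * u ^+ i by rewrite -exprD subnK.
have g1 : 0 <= Ex p s (fun B => (f B <= i)%N%:R) A by apply: Ex_ge0.
have g2 : 0 <= Ex q s (fun B => (j <= f B)%N%:R) A by apply: Ex_ge0.
have := le_trans (ler_pM (mulr_ge0 (exprn_ge0 i (ltW u0)) g1) (mulr_ge0 _ g2) h1 h2)
   (Ex_bicriterion s A u01 hp hq hf).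
rewrite invr_ge0 exprn_ge0 ?(ltW u0) // => /(_ isT).
have -> : u ^+ i * Ex p s (fun B => (f B <= i)%N%:R) A *
    (u ^- j * Ex q s (fun B => (j <= f B)%N%:R) A) = u ^- (j - i) *
    (Ex p s (fun B => (f B <= i)%N%:R) A * Ex q s (fun B => (j <= f B)%N%:R) A).
  by rewrite uj; field; rewrite ?expf_neq0 ?gt_eqF.
by rewrite ler_pdivrMl ?exprn_gt0 // mulr1.
Qed.

End RandomSubset.

(** * Assignment of levels *)

Section Selection.
Variables (R : realFieldType) (E : finType) (N : {set {set E}}).
Hypothesis mN : is_matroid N.

(** The nonempty set [T :\: S] will be the lowest level within [T]: its elements are seldom spanned
    even when all of [S] counts as present. *)
Lemma protected_set (p : E -> R) (b : R) (T : {set E}) : prob p ->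
  \sum_(e in T) p e < b * (rank N T)%:R ->
  exists2 S : {set E}, S \proper T & forall e, e \in T :\: S ->
    Ex p (enum E) (fun B => (spans N (S :|: ((B :&: T) :\ e)) e)%:R) set0 <= b.
Proof.
move=> hp hT.
(* [h S] is the expected rank of [S] with the active part of [T]. As [h set0] is at most the sum of
   [p] over [T], the hypothesis gives [psi T < psi set0]. Adding to [S] an element that it does not
   span earns [1 - b] and costs the growth of [h]. *)
pose h S := Ex p (enum E) (fun B => (rank N (S :|: (B :&: T)))%:R) set0.
pose psi S := (1 - b) * (rank N S)%:R - h S.
have r0 : rank N set0 = 0%N.
  by apply/eqP; rewrite -leqn0 (leq_trans (rank_le_card mN _)) // cards0.
have psiT : psi T < psi set0.
  have -> : psi T = - (b * (rank N T)%:R).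
    rewrite /psi /h (@eq_Ex _ _ p p _ _ (fun=> (rank N T)%:R)) // ?Ex_cst; first by ring.
    by move=> B; rewrite (setUidPl (subsetIr _ _)).
  rewrite /psi r0 mulr0 sub0r ltrN2; apply: le_lt_trans hT.
  apply: (@le_trans _ _ (Ex p (enum E) (fun B => \sum_(e in T) (e \in B)%:R) set0)).
    apply: le_Ex => // B; rewrite set0U -natr_sum ler_nat.
    apply: leq_trans (rank_le_card mN _) _.
    rewrite -sum1_card big_mkcond [X in (_ <= X)%N]big_mkcond leq_sum // => e _.
    by rewrite inE; case: (e \in B); case: (e \in T).
  rewrite Ex_sum; apply: ler_sum => e _; apply: Ex_mem => //; exact: enum_uniq.
(* Adding to [S] an element that is spanned with probability more than [b] does
   not decrease [psi], so a largest [S] with [psi set0 <= psi S] has no such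
   element outside it, and it is not [T]. *)
pose good (S : {set E}) := (S \subset T) && (psi set0 <= psi S).
have g0 : good set0 by rewrite /good sub0set lexx.
case: (arg_maxnP (fun S : {set E} => #|S|) g0) => S /andP[ST psiS] maxS.
exists S.
  rewrite properEneq ST andbT; apply: contraTneq psiS => ->.
  by rewrite -ltNge.
move=> e /setDP[eT eS]; rewrite leNgt; apply/negP => gtb.
suff : good (e |: S).
  by move=> /maxS; rewrite cardsU1 eS /= add1n leqNgt leqnn.
rewrite /good subUset sub1set eT ST /=; apply: le_trans psiS _.
rewrite /psi -subr_ge0.
have -> : (1 - b) * (rank N (e |: S))%:R - h (e |: S) - ((1 - b) * (rank N S)%:R - h S) =
  (1 - b) * (~~ spans N S e)%:R - (h (e |: S) - h S).
  by rewrite (rankU1_spans mN) natrD; ring.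
rewrite subr_ge0 /h -ExB.
have hY B : (rank N (e |: S :|: B :&: T))%:R - (rank N (S :|: B :&: T))%:R =
    (~~ spans N (S :|: B :&: T) e)%:R :> R.
  by rewrite -setUA (rankU1_spans mN) natrD; ring.
have [sS|nS] := boolP (spans N S e).
  rewrite mulr0 -(Ex_cst p (enum E) 0 set0); apply: le_Ex => // B.
  by rewrite hY (spansS mN (subsetUl _ _) sS).
(* For [e] in [B] the rank does not grow, so removing [e] from the spanning set can only enlarge the
   bound. *)
rewrite mulr1; apply: (@le_trans _ _ (Ex p (enum E)
    (fun B => 1 - (spans N (S :|: ((B :&: T) :\ e)) e)%:R) set0)).
  apply: le_Ex => // B; rewrite hY.
  have [sB|_] := boolP (spans N (S :|: ((B :&: T) :\ e)) e).
    rewrite (spansS mN _ sB) ?subrr // setUS // subsetDl //.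
  by rewrite subr0; case: (~~ _).
by rewrite ExB Ex_cst; lra.
Qed.

End Selection.

Section Levels.
Variables (R : realFieldType) (E : finType) (F : {set {set E}}).
Hypothesis mF : is_matroid F.

Definition level_span (N : {set {set E}}) (l : E -> nat) (A : {set E}) (e : E) :=
  spans N [set f | (l e < l f)%N || ((l f == l e) && (f \in A))] e.

Variables (k k' : nat) (b u : R) (p q : E -> R).
Hypotheses (k'0 : (0 < k')%N) (k'k : (k' <= k)%N).
Hypotheses (u01 : 0 < u <= 1) (hp : prob p) (hq : forall e, 0 <= q e <= u * p e).

(** Passes from a bound [b] on spanning in the [k']-fold union at density [p] to an exponentially
    small one in the [k]-fold union at density [q], by applying the product of tails to the number
    of unions that span [e]. *)
Lemma concentrated_span (S T : {set E}) (e : E) : e \notin S ->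
  Ex p (enum E) (fun B => (spans (kfold_union F k') (S :|: ((B :&: T) :\ e)) e)%:R) set0 <= b ->
  (1 - b) * Ex q (enum E) (fun B => (spans (kfold_union F k) (S :|: ((B :&: T) :\ e)) e)%:R) set0
    <= u ^+ (k - k').+1.
Proof.
move=> eS hb.
pose X (B : {set E}) := S :|: ((B :&: T) :\ e).
have eX B : e \notin X B by rewrite !inE negb_or eS eqxx.
pose sp i B := spans (kfold_union F i) (X B) e.
(* Spanning is decreasing in the number of copies, so for [0 < j <= k] the event [sp j B] is the
   threshold event [j <= f B]. *)
pose f B := (\sum_(i < k) sp i.+1 B)%N.
have spdecr i j B : (i <= j)%N -> sp j B -> sp i B.
  by move=> ij; apply: spans_kfold_decr.
have fleq j B : (j <= k)%N -> (\sum_(i < j) sp i.+1 B <= f B)%N.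
  move=> jk; rewrite /f (big_ord_widen_cond k xpredT (fun i => nat_of_bool (sp i.+1 B))) //.
  by rewrite big_mkcond; apply: leq_sum => i _; case: ifP.
have spf j B : (0 < j)%N -> (j <= k)%N -> sp j B = (j <= f B)%N.
  move=> j0 jk; have [spj|nspj] := boolP (sp j B).
    apply/esym; apply: leq_trans (fleq j B jk).
    rewrite (eq_bigr (fun=> 1%N)) ?sum1_card ?card_ord // => i _.
    by rewrite (spdecr i.+1 j).
  apply/esym; apply/negbTE; rewrite -ltnNge /f.
  apply: (@leq_ltn_trans (\sum_(i < j.-1) 1)); last by rewrite sum1_card card_ord prednK.
  rewrite (big_ord_widen_cond k xpredT (fun i => 1%N)); last by rewrite (leq_trans (leq_pred j)).
  rewrite [X in (_ <= X)%N]big_mkcond /=; apply: leq_sum => i _; case: ltnP => // ji.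
    by case: (sp _ _).
  rewrite leqn0 eqb0; apply: contra nspj; apply: spdecr.
  by rewrite -(prednK j0).
have sp0 (B B' : {set E}) i : B \subset B' -> sp i B -> sp i B'.
  move=> BB'; apply: spansS; first exact: kfold_union_matroid.
  by rewrite setUS // setSD // setSI.
(* For the upper bound, term [i.+2] with [a] present is at most term [i.+1] without it; the shift
   leaves over only the first term, which is at most 1. *)
have hf B a : (f B <= f (a |: B) <= (f B).+1)%N.
  apply/andP; split.
    apply: leq_sum => i _; have := @sp0 B (a |: B) i.+1 (subsetUr _ _).
    by case: (sp _ _) => // ->.
  rewrite /f; case: (k) => [|n]; first by rewrite !big_ord0.
  rewrite big_ord_recl /= -[X in (_ <= X)%N]add1n leq_add //; first by case: (sp _ _).
  rewrite [X in (_ <= X)%N]big_ord_recr /=; apply: leq_trans (leq_addr _ _).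
  apply: leq_sum => i _; rewrite /bump /= add1n.
  have [spa|//] := boolP (sp i.+2 (a |: B)).
  have := spans_kfold_setD1 mF a (eX _) spa => h.
  suff -> : sp i.+1 B by [].
  apply: spansS h; first exact: kfold_union_matroid.
  apply/subsetP => g; rewrite !inE => /andP[ga /orP[->//|/andP[-> /andP[gB ->]]]].
  by move: gB; rewrite (negPf ga) /= => ->; rewrite orbT.
have k0 : (0 < k)%N by apply: leq_trans k'k.
have -> : Ex q (enum E) (fun B => (spans (kfold_union F k) (S :|: ((B :&: T) :\ e)) e)%:R) set0
   = Ex q (enum E) (fun B => (k <= f B)%N%:R) set0.
  by apply: eq_Ex => // B; rewrite -spf.
(* Being unspanned in the [k']-fold union means [f B <= k'.-1], so the gap to [k] has one extra
   unit. *)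
have -> : (k - k').+1 = (k - k'.-1)%N by move: k'k k'0; lia.
have k'1k : (k'.-1 <= k)%N by apply: leq_trans k'k; apply: leq_pred.
have := Ex_tail (enum E) set0 u01 hp hq hf k'1k; apply: le_trans.
apply: ler_wpM2r.
  have hq' : prob q.
    move=> a; have /andP[-> h] := hq a; have /andP[p0 p1] := hp a.
    by have /andP[u0 u1] := u01; rewrite (le_trans h) // mulr_ile1 // ltW.
  exact: Ex_ge0.
have -> : Ex p (enum E) (fun B => (f B <= k'.-1)%N%:R) set0 =
   1 - Ex p (enum E) (fun B => (sp k' B)%:R) set0.
  transitivity (Ex p (enum E) (fun B => 1 - (sp k' B)%:R) set0).
    apply: eq_Ex => // B; rewrite spf // -ltnS prednK // ltnNge.
    by case: (k' <= f B)%N; rewrite ?subr0 ?subrr.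
  by rewrite ExB Ex_cst.
by rewrite lerD2l lerN2.
Qed.

Hypothesis hT : forall T : {set E}, T != set0 -> (forall e, e \in T -> [set e] \in F) ->
  \sum_(e in T) p e < b * (rank (kfold_union F k') T)%:R.

(** Induction on a set [T] of non-loops: [protected_set] splits off the lowest level, and the
    remaining proper subset [S] is treated recursively. *)
Lemma levels_exist : exists l : E -> nat, forall e, [set e] \in F ->
  (1 - b) * Ex q (enum E) (fun B => (level_span (kfold_union F k) l (B :\ e) e)%:R) set0
    <= u ^+ (k - k').+1.
Proof.
(* Level 0 is kept for the complement of [T], so that positivity of [l] records membership. *)
have main (T : {set E}) : (forall e, e \in T -> [set e] \in F) ->
  exists l : E -> nat, (forall e, (0 < l e)%N = (e \in T)) /\
    forall e, e \in T ->
  (1 - b) * Ex q (enum E) (fun B => (level_span (kfold_union F k) l (B :\ e) e)%:R) set0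
    <= u ^+ (k - k').+1.
  have [n] := ubnP #|T|; elim: n T => // n IH T; rewrite ltnS => leT TF.
  have [->|T0] := eqVneq T set0.
    by exists (fun=> 0%N); split=> e; rewrite inE.
  have [S ST hS] := protected_set (kfold_union_matroid mF k') hp (hT T0 TF).
  have [|e eS|l [l0 hl]] := IH S; first exact: leq_trans (proper_card ST) leT.
    by apply: TF; apply: (subsetP (proper_sub ST)).
  have lS e : e \notin S -> l e = 0%N by rewrite -l0 -eqn0Ngt => /eqP.
  (* All of [S] moves up by one, which preserves comparisons inside [S], and [T :\: S] gets level 1,
     below all of [S]. *)
  exists (fun e => (l e + (e \in T))%N); split=> [e|e eT].
    rewrite addn_gt0 l0 lt0b; case: (boolP (e \in S)) => //= eS.
    by rewrite (subsetP (proper_sub ST)).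
  have [eS|eS] := boolP (e \in S).
    apply: le_trans (hl e eS); rewrite le_eqVlt; apply/orP; left; apply/eqP.
    congr (_ * _); apply: eq_Ex => // B; congr (_%:R).
    rewrite /level_span; congr (nat_of_bool (spans _ _ e)); apply/setP => f; rewrite !inE eT.
    have le0 : (0 < l e)%N by rewrite l0.
    have [fT|fT] := boolP (f \in T); first by rewrite !addn1 ltnS eqSS.
    have lf : l f = 0%N by apply: lS; apply: contra fT; apply: (subsetP (proper_sub ST)).
    by rewrite lf; move: le0; case: (l e).
  have := hS e; rewrite inE eS eT => /(_ isT) /(concentrated_span eS).
  apply: le_trans; rewrite le_eqVlt; apply/orP; left; apply/eqP.
  congr (_ * _); apply: eq_Ex => // B; congr (_%:R).
  rewrite /level_span; congr (nat_of_bool (spans _ _ e)); apply/setP => f.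
  rewrite !inE eT (lS e eS) add0n.
  have [fT|fT] := boolP (f \in T); last first.
    have fS : f \notin S by apply: contra fT; apply: (subsetP (proper_sub ST)).
    by rewrite (lS f fS) (negPf fS) /= !andbF.
  rewrite addn1 ltnS l0 andbT; have [//|fS] := boolP (f \in S).
  by rewrite lS.
have [e|l [_ hl]] := main [set e | [set e] \in F]; first by rewrite inE.
by exists l => e eF; apply: hl; rewrite inE.
Qed.

End Levels.

From mathcomp Require Import all_classical all_reals all_analysis.
From mathcomp Require Import measurable_realfun.
Import numFieldNormedType.Exports.

(** * The level algorithm *)

Section LevelAlgorithm.
Variables (R : realType) (E : finType) (N : {set {set E}}).
Hypothesis mN : is_matroid N.
Variables (l : E -> nat) (act : E -> R -> bool).

Definition active (x : E -> R) : {set E} := [set e | act e (x e)]%SET.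

Definition taken (h : seq (E * bool)) : {set E} := [set e | (e, true) \in h]%SET.

(** The seed space is a single point: the algorithm is deterministic. *)
Definition level_alg : online_algorithm R E :=
  @OnlineAlgorithm R E _ unit (@dirac _ unit tt R) (fun _ h e y =>
    act e y && ~~ level_span N l (taken [seq (t.1.1, t.2) | t <- h]) e).

Let step (h : seq (E * bool)) (x : E -> R) e :=
  act e (x e) && ~~ level_span N l (taken h) e.

Lemma level_executionS adv x (s : seed level_alg) n :
  execution adv x s n.+1 =
  rcons (execution adv x s n) (adv x (execution adv x s n),
    step (execution adv x s n) x (adv x (execution adv x s n))).
Proof.
rewrite /=; congr rcons; congr (_, _); rewrite /step -map_comp.
by congr (_ && ~~ level_span _ _ (taken _) _); rewrite -[RHS]map_id; apply: eq_map => -[].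
Qed.

Lemma taken_rcons h e b : taken (rcons h (e, b)) = (if b then e |: taken h else taken h)%SET.
Proof.
apply/setP => f; case: b; rewrite !inE mem_rcons inE xpair_eqE ?andbT //.
by rewrite andbF.
Qed.

Definition above m : {set E} := [set f | (m < l f)%N]%SET.
Definition layer m : {set E} := [set f | l f == m]%SET.

(** The part of [A] in layer [m] is independent in the contraction of [N] by [above m]. *)
Definition layered (A : {set E}) := forall m,
  rank N (above m :|: (A :&: layer m)) = (rank N (above m) + #|A :&: layer m|)%N.

Lemma layered_indep A : layered A -> A \in N.
Proof.
move=> lA; pose M := (\max_f l f)%N.
(* Induction on [n] lowers [m] from beyond the largest level, and [rank_contract] adds one layer at
   a time. *)
suff main n m : (M < m + n)%N -> [set f in A | (m <= l f)%N]%SET \in N.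
  have := main M.+1 0%N; rewrite add0n ltnSn => /(_ isT).
  by rewrite (_ : [set f in A | _]%SET = A) //; apply/setP => f; rewrite inE andbT.
elim: n m => [m|n IH m].
  rewrite addn0 => Mm; rewrite (_ : [set f in A | _]%SET = finset.set0).
    by case: mN.
  apply/setP => f; rewrite !inE; apply/negP => /andP[_ mf].
  have : (l f <= M)%N by exact: leq_bigmax.
  by rewrite leqNgt (leq_trans Mm).
rewrite addnS -addSn => /IH h.
have -> : [set f in A | (m <= l f)%N]%SET = ([set f in A | (m < l f)%N] :|: (A :&: layer m))%SET.
  apply/setP => f; rewrite !inE leq_eqVlt [m == _]eq_sym.
  by case: (f \in A) => //=; rewrite orbC.
apply: (rank_contract mN (S := above m)) => //.
  by apply/fintype.subsetP => f; rewrite !inE => /andP[].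
rewrite -finset.setI_eq0; apply/eqP/setP => f; rewrite !inE; case: eqP => [->|_].
  by rewrite ltnn.
by rewrite !andbF.
Qed.

Lemma level_spanE A e :
  level_span N l A e = spans N (above (l e) :|: (A :&: layer (l e))) e.
Proof.
by rewrite /level_span; congr (spans _ _ _); apply/setP => f; rewrite !inE andbC.
Qed.

Lemma layered_execution adv x (s : seed level_alg) n :
  layered (taken (execution adv x s n)).
Proof.
elim: n => [m|n IH].
  have -> : taken (execution adv x s 0) = finset.set0 by apply/setP => f; rewrite !inE.
  by rewrite finset.set0I finset.setU0 cards0 addn0.
rewrite level_executionS taken_rcons; case: ifP => // /andP[_].
move: (adv _ _) (taken _) IH => e A IH; rewrite level_spanE => nsp m.
(* An element already taken is spanned by the taken part of its own layer, so it is not accepted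
   twice. *)
have eA : e \notin A.
  apply: contra nsp => eA; apply/eqP; congr (rank N _); apply/finset.setUidPr.
  by rewrite finset.sub1set !inE eqxx eA orbT.
have [me|me] := eqVneq m (l e); last first.
  rewrite (_ : (e |: A) :&: layer m = A :&: layer m)%SET ?IH //.
  by apply/setP => f; rewrite !inE; case: (eqVneq f e) => //= ->; rewrite eq_sym (negPf me) !andbF.
have -> : ((e |: A) :&: layer m = e |: (A :&: layer m))%SET.
  by apply/setP => f; rewrite !inE; case: (eqVneq f e) => //= ->; rewrite me eqxx.
rewrite finset.setUCA (rankU1_spans mN) me nsp IH cardsU1 !inE (negPf eA) /=.
by rewrite addnCA.
Qed.

Lemma level_alg_feasible : feasible_algorithm N level_alg.
Proof. by move=> adv x s _; apply/layered_indep/layered_execution. Qed.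

Lemma taken_active adv x (s : seed level_alg) n :
  taken (execution adv x s n) \subset active x.
Proof.
elim: n => [|n IH]; first by apply/fintype.subsetP => e; rewrite !inE.
rewrite level_executionS taken_rcons; case: ifP => // /andP[ae _].
by rewrite finset.subUset finset.sub1set IH inE ae.
Qed.

Lemma unzip1_execution adv x (s : seed level_alg) n : legal_adversary adv ->
  (n <= #|E|)%N ->
  size (unzip1 (execution adv x s n)) = n /\ uniq (unzip1 (execution adv x s n)).
Proof.
rewrite /unzip1 => leg; elim: n => // n IH nE; have [sz un] := IH (ltnW nE).
rewrite level_executionS map_rcons size_rcons sz rcons_uniq un andbT; split=> //=.
apply: leg; apply/existsP; apply: contraLR nE; rewrite negb_exists => /forallP h; rewrite -leqNgt -sz -(card_uniqP un).
by apply: subset_leq_card; apply/fintype.subsetP => e _; have := h e; rewrite negbK.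
Qed.

(** A legal adversary presents [e] exactly once. At that moment the taken elements are active and
    differ from [e], so by monotonicity of the span they cannot span [e] with the higher levels
    unless all other active elements do. *)
Lemma selected_accepted adv x (s : seed level_alg) e : legal_adversary adv ->
  act e (x e) -> ~~ level_span N l (active x :\ e)%SET e ->
  e \in accepted adv x s.
Proof.
move=> leg ae nsp; rewrite inE.
have [sz un] := unzip1_execution x s leg (leqnn #|E|).
have : e \in unzip1 (execution adv x s #|E|).
  have /subset_cardP/(_ (subset_predT _)) := etrans (card_uniqP un) sz.
  by move=> ->.
suff main n : (n <= #|E|)%N -> forall b, (e, b) \in execution adv x s n -> b = true.
  by move=> /mapP[[f b] hb /= ef]; rewrite -ef in hb; rewrite -(main _ (leqnn _) _ hb).
elim: n => [//|n IH] nE b; have [_] := unzip1_execution x s leg nE.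
rewrite /unzip1 level_executionS map_rcons rcons_uniq mem_rcons inE => /andP[new _].
case/predU1P => [[ee ->]|]; last exact: IH (ltnW nE) _.
move: new; rewrite /= -ee => new; rewrite /step ae /=.
apply: contra nsp; rewrite !level_spanE; apply: spansS => //.
rewrite finset.setUS // finset.setSI //; apply/fintype.subsetP => f ft.
rewrite !inE; have := fintype.subsetP (taken_active adv x s n) f ft; rewrite inE => ->.
rewrite andbT; apply: contraNneq new => <-; move: ft; rewrite inE => ft.
by apply/mapP; exists (f, true).
Qed.

End LevelAlgorithm.

Local Open Scope classical_set_scope.

(** * Independent values *)

Lemma measurable_boolfun d (T : measurableType d) (b : T -> bool) :
  measurable [set w | b w] -> forall c, measurable [set w | b w = c].
Proof.
move=> mb [//|]; rewrite (_ : [set w | _] = ~` [set w | b w]); first exact: measurableC.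
by apply/seteqP; split=> w /=; case: (b w).
Qed.

Lemma measurable_finset d (T : measurableType d) (I : finType) (g : T -> {set I})
  (Q : {set I} -> bool) :
  (forall i, measurable [set w | i \in g w]) -> measurable [set w | Q (g w)].
Proof.
move=> mg.
rewrite (_ : [set w | _] = \bigcup_(A in [set A | Q A])
    \bigcap_(i in setT) [set w | (i \in g w) = (i \in A)]).
  apply: fin_bigcup_measurable => [|A _]; first exact: finite_finset.
  apply: fin_bigcap_measurable => [|i _]; first exact: finite_finset.
  exact: measurable_boolfun.
apply/seteqP; split=> w /= => [Qw|[A QA h]]; first by exists (g w).
by rewrite (_ : g w = A) //; apply/setP => i; apply: h.
Qed.

Lemma ge0_integral_mrestr d (T : measurableType d) (R : realType)
    (mu : {measure set T -> \bar R}) (Z : set T) (mZ : measurable Z) (f : T -> \bar R) :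
  measurable_fun setT f -> (forall x, (0 <= f x)%E) ->
  (\int[mrestr mu mZ]_x f x = \int[mu]_(x in Z) f x)%E.
Proof.
move=> mf f0.
rewrite [LHS](ge0_negligible_integral (N := ~` Z)) //; last 2 first.
- exact: measurableC.
- by rewrite /= /mrestr setICl measure0.
rewrite setTD setCK; apply: eq_measure_integral => A mA AZ /=.
by rewrite /mrestr setIidl.
Qed.

Section Independence.
Variables (R : realType) (E : finType).
Variables (d : measure_display) (Om : measurableType d) (P : probability Om R).
Variables (v : E -> {RV P >-> R}) (act : E -> R -> bool).
Hypothesis vi : mutually_independent v.
Hypothesis mact : forall e, measurable [set y | act e y].

Let p e := fine (P (v e @^-1` [set y | act e y])).

Lemma measurable_preim e B : measurable B -> measurable (v e @^-1` B).
Proof. by move=> mB; rewrite -[X in measurable X]setTI; exact: measurable_funP. Qed.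

Lemma measurable_active (Q : {set E} -> bool) :
  measurable [set w | Q (active act (v^~ w))].
Proof.
apply: measurable_finset => e; rewrite (_ : [set w | _] = v e @^-1` [set y | act e y]).
  exact: measurable_preim.
by apply/seteqP; split=> w /=; rewrite inE.
Qed.

Lemma measurable_cylinder (K : {set E}) (B : E -> set R) : (forall e, measurable (B e)) ->
  measurable [set w | forall e, e \in K -> B e (v e w)].
Proof.
move=> mB; rewrite (_ : [set w | _] = \bigcap_(e in [set e | e \in K]) (v e @^-1` B e)) //.
by apply: fin_bigcap_measurable => [|e _]; [exact: finite_finset | exact: measurable_preim].
Qed.

Let pat (s : seq E) w : {set E} := [set e | (e \in s) && act e (v e w)]%SET.

Lemma measurable_pat s (Q : {set E} -> bool) : measurable [set w | Q (pat s w)].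
Proof.
apply: measurable_finset => e; have [es|es] := boolP (e \in s).
  rewrite (_ : [set w | _] = v e @^-1` [set y | act e y]); first exact: measurable_preim.
  by apply/seteqP; split=> w /=; rewrite inE es.
rewrite (_ : [set w | _] = set0) //.
by apply/seteqP; split=> w //=; rewrite inE (negPf es).
Qed.

Lemma cylinder_cons (K : {set E}) (B : E -> set R) e (C : set R) :
  (forall f, measurable (B f)) -> measurable C -> e \notin K ->
  let B' := fun f => if f == e then C else B f in
  [set w | forall f, f \in (e |: K)%SET -> B' f (v f w)] =
    (v e @^-1` C) `&` [set w | forall f, f \in K -> B f (v f w)] /\
  P [set w | forall f, f \in (e |: K)%SET -> B' f (v f w)] =
    (P (v e @^-1` C) * P [set w | forall f, f \in K -> B f (v f w)])%E.
Proof.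
move=> mB mC eK B'.
have mB' f : measurable (B' f) by rewrite /B'; case: ifP.
split.
  apply/seteqP; split=> w /= => [h|[hC hB] f].
    split; first by have := h e; rewrite !inE eqxx /B' eqxx; apply.
    move=> f fK; have := h f; rewrite !inE fK orbT => /(_ isT); rewrite /B'.
    by case: eqVneq => // fe; rewrite -fe fK in eK.
  by rewrite /B' !inE; case: eqVneq => [->//|_ /=]; apply: hB.
rewrite vi // vi // big_setU1 //= {1}/B' eqxx; congr (_ * _)%E.
by apply: eq_bigr => f fK; rewrite /B'; case: eqVneq => // fe; rewrite -fe fK in eK.
Qed.

(** The cylinder over [K] is carried through the induction. Peeling [e] off [s] splits on its
    activity and moves [e], with that constraint, into the cylinder; the two cases are the two terms
    in the recursion of [Ex]. *)
Lemma cylinder_pat s (K : {set E}) (B : E -> set R) (A : {set E}) (Q : {set E} -> bool) :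
  uniq s -> (forall e, e \in s -> e \notin K) -> (forall e, measurable (B e)) ->
  P ([set w | forall e, e \in K -> B e (v e w)] `&` [set w | Q (A :|: pat s w)%SET]) =
  (P [set w | forall e, e \in K -> B e (v e w)] *
    (Ex p s (fun S => (Q S)%:R) A)%:E)%E.
Proof.
elim: s K B A => [|e s IH] K B A /=.
  move=> _ _ mB.
  have pat0 w : pat [::] w = finset.set0 by apply/setP => f; rewrite !inE.
  case: (boolP (Q A)) => QA /=.
    rewrite mule1 (_ : [set w | Q _] = setT) ?setIT //.
    by apply/seteqP; split=> w //= _; rewrite pat0 finset.setU0.
  rewrite mule0 (_ : [set w | Q _] = set0) ?setI0 ?measure0 //.
  by apply/seteqP; split=> w //=; rewrite pat0 finset.setU0 (negPf QA).
move=> /andP[es us] sK mB.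
have eK : e \notin K by apply: sK; rewrite mem_head.
have mC : measurable (~` [set y | act e y]) by apply: measurableC.
set H := [set w | forall e, e \in K -> B e (v e w)].
have sK' f : f \in s -> f \notin (e |: K)%SET.
  move=> fs; rewrite !inE negb_or sK ?inE ?fs ?orbT // andbT.
  by apply: contraNneq es => <-.
have [E1 P1] := cylinder_cons mB (mact e) eK.
have [E0 P0] := cylinder_cons mB mC eK.
have mif C f : measurable C -> measurable (if f == e then C else B f) by move=> ?; case: ifP.
have := IH _ _ (e |: A)%SET us sK' (fun f => mif _ f (mact e)).
have := IH _ _ A us sK' (fun f => mif _ f mC).
rewrite P1 P0 E1 E0 -/H.
have -> : P (v e @^-1` (~` [set y | act e y])) = (1 - p e)%:E.
  rewrite preimage_setC probability_setC; last exact: (measurable_preim _ (mact e)).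
  by rewrite EFinB fineK // fin_num_measure //; exact: (measurable_preim _ (mact e)).
have -> : P (v e @^-1` [set y | act e y]) = (p e)%:E.
  by rewrite fineK // fin_num_measure //; exact: measurable_preim.
move=> h0 h1.
have mH : measurable H by exact: measurable_cylinder.
rewrite (_ : H `&` _ =
  ((v e @^-1` [set y | act e y] `&` H) `&` [set w | Q (e |: A :|: pat s w)%SET]) `|`
  ((v e @^-1` (~` [set y | act e y]) `&` H) `&` [set w | Q (A :|: pat s w)%SET])).
  rewrite measureU.
  - apply: etrans (congr2 (fun a b => a + b)%E h1 h0) _.
    rewrite -(fineK (fin_num_measure P H mH)) -!EFinM -EFinD; congr EFin; ring.
  - apply: measurableI (measurable_pat s (fun S => Q (e |: A :|: S)%SET)).
    by apply: measurableI => //; exact: measurable_preim.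
  - apply: measurableI (measurable_pat s (fun S => Q (A :|: S)%SET)).
    by apply: measurableI => //; exact: measurable_preim.
  - by apply/seteqP; split=> w //= [[[? _] _] [[]]].
have patS w : pat (e :: s) w = if act e (v e w) then (e |: pat s w)%SET else pat s w.
  apply/setP => f; case: ifP => ae; rewrite !inE; case: eqVneq => //= ->; rewrite ae ?andbF //.
have setUe w : (A :|: (e |: pat s w) = e |: A :|: pat s w)%SET.
  by rewrite finset.setUCA finset.setUA.
apply/seteqP; split=> w /=; rewrite patS; case: ifP => ae.
- by rewrite setUe => -[]; left.
- by move=> []; right.
- by rewrite setUe => -[[[_ hH] hQ]|[[/(_ isT)]]].
- by move=> [[[//]]|[[_ hH] hQ]].
Qed.

(** As [Q] ignores [e], the list can omit [e], which frees this coordinate for the cylinder [C]. *)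
Lemma independent_selection e (C : set R) (Q : {set E} -> bool) : measurable C ->
  (forall S, Q (e |: S)%SET = Q S) ->
  P (v e @^-1` C `&` [set w | Q (active act (v^~ w))]) =
  (P (v e @^-1` C) * (Ex p (enum E) (fun S => (Q S)%:R) finset.set0)%:E)%E.
Proof.
move=> mC Qe; rewrite (Ex_filter p (enum E) finset.set0 (e := e)); last first.
  by move=> S; rewrite Qe.
have := @cylinder_pat (seq.filter (predC1 e) (enum E)) [set e]%SET (fun=> C) finset.set0 Q.
rewrite (_ : [set w | forall f, _] = v e @^-1` C); last first.
  apply/seteqP; split=> w /= => [/(_ e)|h f]; first by rewrite inE eqxx; apply.
  by rewrite inE => /eqP ->.
rewrite filter_uniq ?enum_uniq // => /(_ isT) <- //; last first.
  by move=> f; rewrite mem_filter => /andP[/= fe _]; rewrite inE.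
have main w : Q (finset.set0 :|: pat (seq.filter (predC1 e) (enum E)) w)%SET = Q (active act (v^~ w)).
  rewrite finset.set0U -Qe -[RHS]Qe; congr (Q _); apply/setP => f.
  by rewrite !inE mem_filter /= mem_enum andbT; case: eqVneq.
by under [X in P (_ `&` X)]eq_set do rewrite -main.
Qed.

(** By [independent_selection], the law of [v e] restricted to the event [Q] is its full law scaled
    by a constant; integrals of [g] scale accordingly. *)
Lemma integral_selection e (g : R -> R) (Q : {set E} -> bool) :
  measurable_fun setT g -> (forall y, 0 <= g y) ->
  (forall S, Q (e |: S)%SET = Q S) ->
  (\int[P]_w (g (v e w) * (Q (active act (v^~ w)))%:R)%:E =
   \int[distribution P (v e)]_y (g y)%:E *
     (Ex p (enum E) (fun S => (Q S)%:R) finset.set0)%:E)%E.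
Proof.
move=> mg g0 Qe; set Z := [set w | Q (active act (v^~ w))].
have mZ : measurable Z by exact: measurable_active.
have mgv : measurable_fun setT (EFin \o (g \o v e)).
  by apply/measurable_EFinP; apply: measurableT_comp.
have -> : (\int[P]_w (g (v e w) * (Q (active act (v^~ w)))%:R)%:E =
  \int[P]_(w in Z) (g (v e w))%:E)%E.
  rewrite [RHS]integral_mkcond; apply: eq_integral => w _; rewrite patchE.
  have [wZ|wZ] := boolP (w \in Z).
    by rewrite (_ : Q _) ?mulr1 //; move: wZ; rewrite inE.
  by case: (boolP (Q _)) => [hQ|_]; [rewrite mem_set in wZ | rewrite mulr0].
rewrite -(ge0_integral_mrestr P mZ mgv); last by move=> w; rewrite /= lee_fin.
have Ex0 : 0 <= Ex p (enum E) (fun S => (Q S)%:R) finset.set0.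
  apply: Ex_ge0 => [f|S]; last by [].
  have mf : measurable (v f @^-1` [set y | act f y]) by exact: measurable_preim.
  by rewrite -!lee_fin fineK ?measure_ge0 ?probability_le1 ?fin_num_measure.
pose c : {nonneg R} := NngNum Ex0.
have mG : measurable_fun setT (EFin \o g) by apply/measurable_EFinP.
rewrite muleC -[(Ex _ _ _ _)%:E]/((c%:num)%:E) -ge0_integral_mscale //; last first.
  by move=> y _; rewrite lee_fin.
rewrite -[LHS](@ge0_integral_pushforward _ _ _ _ R (v e) _ (mrestr P mZ) setT (EFin \o g)) //; last first.
  by move=> y _; rewrite /= lee_fin.
apply: eq_measure_integral => A mA _ /=.
rewrite /mscale /pushforward /mrestr /= independent_selection // muleC.
by rewrite /distribution /pushforward.
Qed.

End Independence.

(** * Thresholds *)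

Section BoolIntegral.
Variables (R : realType) (d : measure_display) (T : measurableType d).

Lemma bool_indic (b : T -> bool) : (fun w => (b w)%:R : R) = \1_[set w | b w].
Proof. by apply/funext => w; rewrite indicE mem_setE. Qed.

Lemma measurable_bool_real (b : T -> bool) : measurable [set w | b w] ->
  measurable_fun setT (fun w => (b w)%:R : R).
Proof. by move=> mb; rewrite bool_indic; apply: measurable_indic. Qed.

Lemma integral_bool (P : {measure set T -> \bar R}) (b : T -> bool) :
  measurable [set w | b w] -> (\int[P]_w ((b w)%:R)%:E = P [set w | b w])%E.
Proof.
move=> mb; rewrite -[in RHS](setIT [set w | b w]) -integral_indic //.
by apply: eq_integral => w _; rewrite -[in RHS]bool_indic.
Qed.

End BoolIntegral.

Section Quantile.
Variables (R : realType) (D : probability R R).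

(* The reward collected by accepting the values of [hi] surely and those of
   [eq] with probability [b]. *)
Definition threshold_reward (hi eq : R -> bool) (b : R) : \bar R :=
  (\int[D]_y (y * ((hi y)%:R + b * (eq y)%:R))%:E)%E.

Definition threshold (hi eq : R -> bool) :=
  [/\ measurable [set y | hi y], measurable [set y | eq y],
      forall y, hi y || eq y -> 0 <= y & forall y, hi y -> ~~ eq y].

Definition threshold_prob (hi eq : R -> bool) (b : R) : R :=
  fine (D [set y | hi y]) + b * fine (D [set y | eq y]).

Local Notation Gt t := (`]t, +oo[%classic : set R).
Local Notation Ge t := (`[t, +oo[%classic : set R).

(** The quantile is the infimum of the [t >= 0] whose open tail has mass at most [q]. Continuity of
    [D] along increasing and decreasing tails gives the two bounds. *)
Lemma quantile_exists (q : R) : 0 < q -> (q%:E < D (Ge 0%R))%E ->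
  exists2 t, 0 <= t & (D (Gt t) <= q%:E <= D (Ge t))%E.
Proof.
move=> q0 qD; pose S := [set t : R | 0 <= t /\ (D (Gt t) <= q%:E)%E].
have Dmono (s t : R) : s <= t -> (D (Gt t) <= D (Gt s))%E.
  move=> st; apply: le_measure; rewrite ?inE //.
  by apply: subset_itvr; rewrite bnd_simp.
have S0 : S !=set0.
  have : D (Gt (n%:R)%R) @[n --> \oo] --> D (\bigcap_n (Gt (n%:R)%R)).
    apply: (@nonincreasing_cvg_mu _ _ _ D (fun n => (Gt (n%:R)%R))) => //.
    - by rewrite ltey_eq fin_num_measure.
    - by apply: bigcapT_measurable => n.
    - move=> m n mn; apply/subsetPset; apply: subset_itvr.
      by rewrite bnd_simp ler_nat.
  rewrite (_ : \bigcap_n _ = set0) ?measure0; last first.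
    apply/seteqP; split=> // x /= h.
    have := h (Num.truncn `|x|).+1 I; rewrite /= in_itv /= andbT => lt.
    have := truncnS_gt `|x|; rewrite ltNge => /negP; apply.
    by apply: ltW; apply: lt_le_trans lt _; apply: ler_norm.
  move=> /fine_cvgP[_ /cvgrPdist_le /(_ q q0)[n _ /(_ n (leqnn n))]] /=.
  rewrite sub0r normrN ger0_norm ?fine_ge0 // => h.
  exists n%:R; split=> //.
  by rewrite -(fineK (fin_num_measure D _ (measurable_itv _))) lee_fin.
have Slb : has_inf S by split=> //; exists 0 => t [].
pose t := inf S.
have t0 : 0 <= t by apply: lb_le_inf => // s [].
exists t => //; apply/andP; split.
  have : D (Gt (t + n.+1%:R^-1)%R) @[n --> \oo] --> D (\bigcup_n (Gt (t + n.+1%:R^-1)%R)).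
    apply: (@nondecreasing_cvg_mu _ _ _ D (fun n => (Gt (t + n.+1%:R^-1)%R))) => //.
    - by apply: bigcupT_measurable => n.
    - move=> m n mn; apply/subsetPset; apply: subset_itvr.
      by rewrite bnd_simp lerD2l lef_pV2 ?posrE // ler_nat.
  rewrite (_ : \bigcup_n _ = (Gt t)); last first.
    apply/seteqP; split=> x /=.
      move=> [n _]; rewrite /= !in_itv /= !andbT; apply: le_lt_trans.
      by rewrite lerDl.
    rewrite in_itv /= andbT => tx.
    exists (Num.truncn (x - t)^-1) => //=; rewrite in_itv /= andbT.
    rewrite -ltrBrDl invf_plt ?posrE ?subr_gt0 //; exact: truncnS_gt.
  move=> h; rewrite -(cvg_lim _ h) //; apply: lime_le; first by apply/cvg_ex; eexists; exact: h.
  apply: nearW => n.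
  have [|s [s0 sq] st] := @inf_adherent _ S n.+1%:R^-1 _ Slb; first by [].
  by apply: le_trans sq; apply: Dmono; apply: ltW.
(* The set [S] contains no negative numbers, so for [s < 0] the assumption on the mass of the
   nonnegative values is used instead. *)
have lt_t s : s < t -> (q%:E <= D (Gt s))%E.
  move=> st; have [s0|s0] := ltP s 0.
    apply: le_trans (ltW qD) _; apply: le_measure; rewrite ?inE //.
    by apply: subset_itvr; rewrite bnd_simp.
  rewrite leNgt; apply/negP => h.
  have : t <= s by apply: ge_inf; [exists 0 => ? [] | split=> //; apply: ltW].
  by rewrite leNgt st.
have : D (Gt (t - n.+1%:R^-1)%R) @[n --> \oo] --> D (\bigcap_n (Gt (t - n.+1%:R^-1)%R)).
  apply: (@nonincreasing_cvg_mu _ _ _ D (fun n => (Gt (t - n.+1%:R^-1)%R))) => //.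
  - by rewrite ltey_eq fin_num_measure.
  - by apply: bigcapT_measurable => n.
  - move=> m n mn; apply/subsetPset; apply: subset_itvr.
    by rewrite bnd_simp lerD2l lerN2 lef_pV2 ?posrE // ler_nat.
rewrite (_ : \bigcap_n _ = (Ge t)); last first.
  apply/seteqP; split=> x /=; rewrite in_itv /= andbT.
    move=> h; rewrite leNgt; apply/negP => xt.
    have := h (Num.truncn (t - x)^-1) I; rewrite /= in_itv /= andbT.
    apply/negP; rewrite -leNgt lerBrDr -lerBrDl.
    by rewrite invf_ple ?posrE ?subr_gt0 // ltW // truncnS_gt.
  move=> tx n _ /=; rewrite in_itv /= andbT; apply: lt_le_trans tx.
  by rewrite ltrBlDr ltrDl.
move=> h; rewrite -(cvg_lim _ h) //; apply: lime_ge; first by apply/cvg_ex; eexists; exact: h.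
by apply: nearW => n; apply: lt_t; rewrite ltrBlDr ltrDl.
Qed.

Lemma measurable_threshold hi eq b : threshold hi eq ->
  measurable_fun setT (fun y : R => y * ((hi y)%:R + b * (eq y)%:R)).
Proof.
move=> [mh me _ _]; apply: measurable_funM => //; apply: measurable_funD.
  exact: measurable_bool_real.
by apply: measurable_funM => //; exact: measurable_bool_real.
Qed.

Lemma threshold_ge0 hi eq b y : threshold hi eq -> 0 <= b ->
  0 <= y * ((hi y)%:R + b * (eq y)%:R).
Proof.
move=> [_ _ h _] b0; have := h y; case: (hi y); case: (eq y) => //= h0.
- by rewrite mulr_ge0 ?h0 // mulr1 addr_ge0.
- by rewrite mulr_ge0 ?h0 // mulr0 addr0.
- by rewrite mulr_ge0 ?h0 // mulr1 add0r.
- by rewrite mulr0 addr0 mulr0.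
Qed.

Lemma threshold_reward_ge0 hi eq b : threshold hi eq -> 0 <= b ->
  (0 <= threshold_reward hi eq b)%E.
Proof. by move=> th b0; apply: integral_ge0 => y _; rewrite lee_fin threshold_ge0. Qed.

Lemma threshold_reward_affine hi eq b0 b1 t : threshold hi eq ->
  0 <= t <= 1 -> 0 <= b0 -> 0 <= b1 ->
  (threshold_reward hi eq ((1 - t) * b0 + t * b1) =
   (1 - t)%:E * threshold_reward hi eq b0 + t%:E * threshold_reward hi eq b1)%E.
Proof.
move=> th /andP[t0 t1] b00 b10; have t1' : 0 <= 1 - t by rewrite subr_ge0.
have m b : measurable_fun setT (EFin \o (fun y : R => y * ((hi y)%:R + b * (eq y)%:R))).
  by apply/measurable_EFinP; exact: measurable_threshold.
have g b y : 0 <= b -> (0 <= (EFin \o (fun y => (y * ((hi y)%:R + b * (eq y)%:R))%R)) y)%E.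
  by move=> ?; rewrite lee_fin threshold_ge0.
rewrite /threshold_reward -!ge0_integralZl // ?lee_fin //; try by [move=> y _; exact: g | exact: m].
rewrite -ge0_integralD //.
- by apply: eq_integral => y _; rewrite -!EFinM -EFinD; congr EFin; ring.
- by move=> y _; rewrite mule_ge0 ?lee_fin //; exact: threshold_ge0.
- by apply: measurable_funeM; exact: m.
- by move=> y _; rewrite mule_ge0 ?lee_fin //; exact: threshold_ge0.
- by apply: measurable_funeM; exact: m.
Qed.

Section Exchange.
Variables (d : measure_display) (Om : measurableType d) (P : probability Om R).
Variables (X : {RV P >-> R}) (O : set Om).
Hypothesis XD : forall B, measurable B -> distribution P X B = D B.
Hypothesis mO : measurable O.

Lemma integral_law (f : R -> R) : measurable_fun setT f -> (forall y, 0 <= f y) ->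
  (\int[D]_y (f y)%:E = \int[P]_w (f (X w))%:E)%E.
Proof.
move=> mf f0; rewrite -(@ge0_integral_distribution _ _ _ _ _ P X (EFin \o f)) //.
- by apply/esym; apply: eq_measure_integral => A mA _; exact: XD.
- exact/measurable_EFinP.
Qed.

Lemma threshold_prob_law hi eq b : threshold hi eq -> 0 <= b ->
  (\int[P]_w ((hi (X w))%:R + b * (eq (X w))%:R)%:E = (threshold_prob hi eq b)%:E)%E.
Proof.
move=> [mh me _ _] b0; rewrite -(integral_law (f := fun y => (hi y)%:R + b * (eq y)%:R)).
- under eq_integral do rewrite EFinD.
  rewrite ge0_integralD //; last 3 first.
  + by apply/measurable_EFinP; exact: measurable_bool_real.
  + by move=> y _; rewrite lee_fin mulr_ge0.
  + apply/measurable_EFinP; apply: measurable_funM => //; exact: measurable_bool_real.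
  under [X in (_ + X)%E]eq_integral do rewrite EFinM.
  rewrite ge0_integralZl //; last first.
    by apply/measurable_EFinP; exact: measurable_bool_real.
  by rewrite !integral_bool // EFinD EFinM !fineK // fin_num_measure.
- apply: measurable_funD; first exact: measurable_bool_real.
  by apply: measurable_funM => //; exact: measurable_bool_real.
- by move=> y; rewrite addr_ge0 // mulr_ge0.
Qed.

Let pos w := Num.max (X w) 0 * \1_O w.

Lemma measurable_pos : measurable_fun setT pos.
Proof.
apply: measurable_funM; last exact: measurable_indic.
by apply: measurable_maxr => //; exact: measurable_funP.
Qed.

Lemma pos_ge0 w : 0 <= pos w.
Proof. by rewrite mulr_ge0 // le_max lexx orbT. Qed.

(** A Neyman-Pearson argument: accepting with probability [th] on the event [O] has the same total
    acceptance probability as the threshold rule, which puts this mass on the largest values. *)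
Lemma threshold_exchange (t th : R) : 0 <= t -> 0 <= th <= 1 -> 
  let hi y := t < y in let eq y := y == t in
  forall b, 0 <= b -> th * fine (P O) = threshold_prob hi eq b -> 
  (th%:E * \int[P]_w (pos w)%:E <= threshold_reward hi eq b)%E.
Proof.
move=> t0 /andP[th0 th1] hi eq b b0 hq.
have thr : threshold hi eq.
  split=> [||y|y].
  - rewrite (_ : [set y | _] = `]t, +oo[%classic) //.
    by apply/seteqP; split=> y; rewrite /= in_itv /= andbT.
  - by rewrite (_ : [set y | _] = [set t]) //; apply/seteqP; split=> y /= /eqP.
  - by case/orP => [/ltW|/eqP->] //; apply: le_trans.
  - by rewrite /hi /eq => /gt_eqF ->.
set q := threshold_prob hi eq b in hq.
have mX (f : R -> R) : measurable_fun setT f -> measurable_fun setT (fun w => f (X w)).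
  by move=> mf; apply: measurableT_comp.
pose a y : R := (hi y)%:R + b * (eq y)%:R.
have a0 y : 0 <= a y by rewrite addr_ge0 // mulr_ge0.
have [mh me _ _] := thr.
have ma : measurable_fun setT a.
  apply: measurable_funD; first exact: measurable_bool_real.
  by apply: measurable_funM => //; exact: measurable_bool_real.
(* Pointwise form of (X - t) * th * 1_O <= (X - t) * a(X), with subtractions moved across and [X]
   truncated at 0. The two terms with factor [t] have the same integral [t * q]. *)
have key w : th * pos w + t * a (X w) <= X w * a (X w) + t * th * \1_O w.
  rewrite /pos /a /hi /eq indicE; case: (ltgtP t (X w)) => [tX|Xt|<-] /=.
  - rewrite max_l; last exact: le_trans t0 (ltW tX).
    rewrite mulr0 addr0 !mulr1.
    have h : 0 <= (X w - t) * (1 - th) by rewrite mulr_ge0 // subr_ge0 // ltW.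
    have h' : 0 <= X w - t by rewrite subr_ge0 ltW.
    case: (w \in O); rewrite ?mulr1 ?mulr0; lra.
  - rewrite mulr0 addr0 mulr0 addr0 mulr0 add0r; case: (w \in O); rewrite ?mulr1 ?mulr0 //.
    by rewrite mulrC ler_wpM2r // ge_max (ltW Xt).
  - rewrite max_l // add0r; case: (w \in O); rewrite ?mulr1 ?mulr0 ?addr0 ?add0r //.
    by rewrite mulrC addrC.
rewrite /threshold_reward (integral_law (measurable_threshold b thr)); last first.
  by move=> y; exact: threshold_ge0.
(* The reward may be infinite, so the finite quantity [t * q] is added to both sides rather than
   subtracted. *)
rewrite -(@leeD2rE _ (t * q)%:E) //.
have -> : (t * q)%:E = (\int[P]_w (t * a (X w))%:E)%E.
  under eq_integral do rewrite EFinM.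
  rewrite ge0_integralZl // ?lee_fin //; first by rewrite threshold_prob_law.
  - by apply/measurable_EFinP; apply: mX.
  - by move=> w _; rewrite lee_fin.
rewrite -ge0_integralZl ?lee_fin //; last 2 first.
- by apply/measurable_EFinP; exact: measurable_pos.
- by move=> w _; rewrite lee_fin pos_ge0.
have -> : (\int[P]_w (X w * ((hi (X w))%:R + b * (eq (X w))%:R))%:E +
    \int[P]_w (t * a (X w))%:E = 
    \int[P]_w (X w * a (X w))%:E + \int[P]_w (t * th * \1_O w)%:E)%E.
  congr (_ + _)%E.
  transitivity ((t * q)%:E).
    under eq_integral do rewrite EFinM.
    rewrite ge0_integralZl // ?lee_fin //; first by rewrite threshold_prob_law.
    - by apply/measurable_EFinP; apply: mX.
    - by move=> w _; rewrite lee_fin.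
  under eq_integral do rewrite EFinM.
  rewrite ge0_integralZl // ?lee_fin ?mulr_ge0 //; last first.
    by apply/measurable_EFinP; exact: measurable_indic.
  rewrite integral_indic // setIT -[X in (_ * X)%E](fineK (fin_num_measure P O mO)) -EFinM.
  by rewrite -hq mulrA.
rewrite -!ge0_integralD //.
- apply: ge0_le_integral => //.
  + move=> w _; rewrite -EFinM -EFinD lee_fin.
    by apply: addr_ge0; apply: mulr_ge0 => //; exact: pos_ge0.
  + apply: emeasurable_funD.
      by apply: measurable_funeM; apply/measurable_EFinP; exact: measurable_pos.
    by apply/measurable_EFinP; apply: measurable_funM => //; exact: mX.
  + apply: emeasurable_funD; apply/measurable_EFinP.
      by apply: measurable_funM; [exact: measurable_funP | exact: mX].
    by apply: measurable_funM => //; exact: measurable_indic.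
  + by move=> w _; rewrite -EFinM -!EFinD lee_fin.
- by move=> w _; rewrite lee_fin; exact: threshold_ge0.
- apply/measurable_EFinP; apply: measurable_funM; [exact: measurable_funP | exact: mX].
- by move=> w _; rewrite lee_fin !mulr_ge0.
- by apply/measurable_EFinP; apply: measurable_funM => //; exact: measurable_indic.
- by move=> w _; rewrite -EFinM lee_fin; apply: mulr_ge0 => //; exact: pos_ge0.
- by apply: measurable_funeM; apply/measurable_EFinP; exact: measurable_pos.
- by move=> w _; rewrite lee_fin mulr_ge0.
- by apply/measurable_EFinP; apply: measurable_funM => //; exact: mX.
Qed.

End Exchange.

End Quantile.

(** Three cases: nothing is accepted for [q = 0], every nonnegative value if these have mass at most
    [q], and otherwise a quantile is the threshold. The rule is fixed before the probability space,
    since the algorithm may depend only on [D]. *)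
Lemma threshold_exists (R : realType) (D : probability R R) (q : R) : 0 <= q ->
  exists hi eq b, [/\ threshold hi eq, 0 <= b <= 1, threshold_prob D hi eq b <= q &
    forall (d : measure_display) (Om : measurableType d) (P : probability Om R)
      (X : {RV P >-> R}) (O : set Om) (th : R),
      (forall B, measurable B -> distribution P X B = D B) -> measurable O ->
      0 <= th <= 1 -> th * fine (P O) = q ->
      (th%:E * \int[P]_w (Num.max (X w) 0 * \1_O w)%:E <= threshold_reward D hi eq b)%E].
Proof.
have set_false : [set y : R | false] = set0 by apply/seteqP; split.
rewrite le_eqVlt => /predU1P[<-|q0].
  have thr : threshold (fun _ : R => false) (fun=> false).
    by split=> [||y|y] //; rewrite set_false.
  exists (fun=> false), (fun=> false), 0; split=> //.
  - by rewrite lexx ler01.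
  - by rewrite /threshold_prob mul0r addr0 set_false measure0.
  - move=> d Om P X O th XD mO /andP[th0 _] /eqP; rewrite mulf_eq0 => /orP[/eqP->|].
      by rewrite mul0e threshold_reward_ge0.
    rewrite fine_eq0 ?fin_num_measure // => /eqP PO.
    rewrite (ge0_negligible_integral (N := O)) //.
    + rewrite [X in (_ * X)%E]integral0_eq ?mule0 ?threshold_reward_ge0 // => w [_ wO].
      by rewrite indicE memNset // mulr0.
    + by apply/measurable_EFinP; exact: measurable_pos.
    + by move=> w _; rewrite lee_fin pos_ge0.
have [Dq|Dq] := leP (D `[0%R, +oo[%classic) q%:E.
  have e0 : [set y : R | 0 <= y] = `[0, +oo[%classic.
    by apply/seteqP; split=> y; rewrite /= in_itv /= andbT.
  have thr : threshold (fun y : R => 0 <= y) (fun=> false).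
    by split=> [||y|y] //; rewrite ?e0 ?set_false ?orbF.
  exists (fun y => 0 <= y), (fun=> false), 0; split=> //.
  - by rewrite lexx ler01.
  - by rewrite /threshold_prob mul0r addr0 e0 -lee_fin fineK // fin_num_measure.
  - move=> d Om P X O th XD mO /andP[th0 th1] _.
    rewrite /threshold_reward (integral_law XD (measurable_threshold 0 thr)); last first.
      by move=> y; exact: threshold_ge0.
    rewrite -ge0_integralZl ?lee_fin //; last 2 first.
    + by apply/measurable_EFinP; exact: measurable_pos.
    + by move=> w _; rewrite lee_fin pos_ge0.
    apply: ge0_le_integral => //.
    + by move=> w _; rewrite -EFinM lee_fin mulr_ge0 ?pos_ge0.
    + by apply: measurable_funeM; apply/measurable_EFinP; exact: measurable_pos.
    + apply/measurable_EFinP.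
      by apply: (measurableT_comp (measurable_threshold 0 thr)); exact: measurable_funP.
    + move=> w _; rewrite -EFinM lee_fin mul0r addr0 indicE.
      apply: (@le_trans _ _ (Num.max (X w) 0 * (w \in O)%:R)).
        by apply: ler_piMl => //; rewrite mulr_ge0 // le_max lexx orbT.
      have [X0|X0] := leP 0 (X w); last by rewrite mul0r mulr0.
      by rewrite mulr1 ler_piMr //; case: (w \in O); rewrite ?ler01.
have [t t0 /andP[tq qt]] := quantile_exists q0 Dq.
pose a := fine (D `]t, +oo[%classic); pose c := fine (D [set t]).
have c0 : 0 <= c by apply: fine_ge0.
have eqa : [set y | t < y] = `]t, +oo[%classic.
  by apply/seteqP; split=> y; rewrite /= in_itv /= andbT.
have eqc : [set y | y == t] = [set t] by apply/seteqP; split=> y /= /eqP.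
have aq : a <= q by rewrite -lee_fin fineK // fin_num_measure.
have qac : q <= a + c.
  rewrite -lee_fin EFinD !fineK ?fin_num_measure //; apply: le_trans qt _.
  rewrite -measureU //; last by apply/seteqP; split=> // y [] /= h yt; move: h; rewrite yt in_itv /= ltxx.
  apply: le_measure; rewrite ?inE //; first exact: measurableU.
  move=> y /=; rewrite !in_itv /= !andbT le_eqVlt => /predU1P[->|]; [by right|by left].
(* The bias splits the atom at [t] so that the acceptance probability is exactly [q]; without an
   atom, [a = q] already. *)
have [b /andP[b0 b1] hb] : exists2 b, 0 <= b <= 1 & a + b * c = q.
  have [c00|c00] := eqVneq c 0.
    by exists 0; rewrite ?lexx ?ler01 // mul0r; apply/eqP; rewrite eq_le; lra.
  have cp : 0 < c by rewrite lt_neqAle eq_sym c00.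
  exists ((q - a) / c); last by rewrite divfK //; ring.
  by rewrite divr_ge0 ?subr_ge0 //= ler_pdivrMr // mul1r; lra.
exists (fun y => t < y), (fun y => y == t), b; split.
- split=> [||y|y]; rewrite ?eqa ?eqc //.
  - by case/orP => [/ltW|/eqP->] //; apply: le_trans.
  - by move=> /gt_eqF ->.
- by rewrite b0.
- by rewrite /threshold_prob eqa eqc hb.
- move=> d Om P X O th XD mO th01 hth.
  by apply: threshold_exchange => //; rewrite hth /threshold_prob eqa eqc hb.
Qed.

(** Coordinates are rounded one at a time to the better endpoint. The hypothesis is the consequence
    of affinity that this uses. *)
Lemma affine_vertex (R : realType) (E : finType) (L : (E -> R) -> \bar R) (b : E -> R) :
  (forall e, 0 <= b e <= 1) ->
  (forall (a : E -> R) f, (forall e, 0 <= a e <= 1) ->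
    (L a <= L (fun e => if e == f then 0%R else a e))%E \/
    (L a <= L (fun e => if e == f then 1%R else a e))%E) ->
  exists c : E -> bool, (L b <= L (fun e => (c e)%:R%R))%E.
Proof.
move=> b01 hL.
suff [a [_ hs ab]] : exists a : E -> R, [/\ forall e, 0 <= a e <= 1,
    forall e, e \in enum E -> exists c : bool, a e = c%:R & (L b <= L a)%E].
  exists (fun e => a e == 1); rewrite (_ : (fun e => _) = a) //; apply/funext => e.
  have [[] ->] := hs e (mem_enum _ e); first by rewrite eqxx.
  by rewrite eq_sym oner_eq0.
elim: (enum E) => [|f s [a [a01 hs ab]]]; first by exists b; split.
have [h|h] := hL a f a01.
  exists (fun e => if e == f then 0 else a e); split=> [e|e|].
  - by case: ifP => // _; rewrite lexx ler01.
  - rewrite inE; case: eqVneq => //= _; first by exists false.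
    exact: hs.
  - exact: le_trans h.
exists (fun e => if e == f then 1 else a e); split=> [e|e|].
- by case: ifP => // _; rewrite lexx ler01.
- rewrite inE; case: eqVneq => //= _; first by exists true.
  exact: hs.
- exact: le_trans h.
Qed.

(** * Joint law of the values and a measurable offline optimum *)

Section JointLaw.
Variables (R : realType) (E : finType).

(** A generating family, closed under intersection, of the product sigma-algebra on [E -> R]. *)
Definition boxes : set (set (E -> R)) :=
  [set C | exists2 B : E -> set R, (forall e, measurable (B e)) &
    C = [set f | forall e, B e (f e)]].

Local Notation T := (g_sigma_algebraType boxes).

Lemma measurable_proj e : measurable_fun setT (fun f : T => f e).
Proof.
move=> _ B mB; rewrite setTI; apply: sub_gen_smallest.
exists (fun f => if f == e then B else setT) => [f|]; first by case: ifP.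
apply/seteqP; split=> f /= => [Bf g|/(_ e)]; last by rewrite eqxx.
by case: eqVneq => // ->.
Qed.

Section Vector.
Variables (d : measure_display) (Om : measurableType d) (P : probability Om R).
Variable v : E -> {RV P >-> R}.

Lemma measurable_vector : measurable_fun setT (fun w => v^~ w : T).
Proof.
apply: (@measurability _ _ Om T setT (fun w => v^~ w) boxes erefl).
move=> _ [_ [B mB ->] <-]; rewrite setTI.
have := measurable_cylinder v [set: E]%SET mB; congr (measurable _).
by apply/seteqP; split=> w /= h e; [apply: h; rewrite inE | move=> _; apply: h].
Qed.

End Vector.

(** Independence fixes the probability of every box, and measures agreeing on such a family are
    equal. Hence the probability that an element is in the optimum depends on the marginals only. *)
Lemma joint_law_unique (d d' : measure_display) (Om : measurableType d) (Om' : measurableType d')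
    (P : probability Om R) (P' : probability Om' R)
    (v : E -> {RV P >-> R}) (v' : E -> {RV P' >-> R}) :
  mutually_independent v -> mutually_independent v' ->
  (forall e B, measurable B -> distribution P (v e) B = distribution P' (v' e) B) ->
  forall C : set T, measurable C ->
    P [set w | C (v^~ w)] = P' [set w | C (v'^~ w)].
Proof.
move=> vi vi' law C mC.
pose X : {RV P >-> T} := mfun_Sub (mem_set (measurable_vector v)).
pose X' : {RV P' >-> T} := mfun_Sub (mem_set (measurable_vector v')).
apply: (@measure_unique _ R T boxes (fun=> setT) _ _ _ _ (distribution P X) (distribution P' X')) => //.
- move=> _ _ [B mB ->] [B' mB' ->]; exists (fun e => B e `&` B' e).
    by move=> e; apply: measurableI.
  by apply/seteqP; split=> f /= => [[h h'] e|h]; [split | split=> e; have [] := h e].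
- move=> _; exists (fun=> setT) => //; by apply/seteqP; split.
- by rewrite bigcup_const.
- move=> _ [B mB ->]; rewrite /= /distribution /pushforward.
  have cyl d1 (O1 : measurableType d1) (P1 : probability O1 R) (v1 : E -> {RV P1 >-> R}) :
     mutually_independent v1 ->
     P1 [set w | forall e, B e (v1 e w)] = (\prod_(e in [set: E]%SET) P1 (v1 e @^-1` B e))%E.
    move=> h; rewrite -h //; congr (P1 _).
    by apply/seteqP; split=> w /= h' e; [move=> _; apply: h' | apply: h'; rewrite inE].
  rewrite -[LHS]/(P [set w | forall e, B e (v e w)]) -[RHS]/(P' [set w | forall e, B e (v' e w)]).
  by rewrite !cyl //; apply: eq_bigr => e _; apply: law.
- by move=> k; rewrite ltey_eq fin_num_measure.
Qed.

End JointLaw.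

Section OptimalSet.
Variables (R : realType) (E : finType) (G : {set {set E}}).
Hypothesis G0 : finset.set0 \in G.

Definition maximizers (x : E -> R) : {set {set E}} :=
  [set A in G | [forall B in G, \sum_(e in B) x e <= \sum_(e in A) x e]]%SET.

(** Ties are broken by a choice depending only on the finite set of maximizers, so measurability
    reduces to finitely many comparisons of sums. *)
Definition optimal_set (x : E -> R) : {set E} :=
  odflt finset.set0 [pick A in maximizers x].

Lemma optimal_set_in (x : E -> R) : optimal_set x \in G.
Proof. by rewrite /optimal_set; case: pickP => //= A; rewrite inE => /andP[]. Qed.

Lemma offline_optimum_ge0 (x : E -> R) : 0 <= offline_optimum G x.
Proof. by rewrite /offline_optimum; elim/big_rec: _ => // A y _ y0; rewrite le_max y0 orbT. Qed.

Lemma offline_optimum_set (x : E -> R) : offline_optimum G x = \sum_(e in optimal_set x) x e.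
Proof.
have [A [AG hA]] : exists A, A \in G /\ forall B, B \in G -> \sum_(e in B) x e <= \sum_(e in A) x e.
  case: (@Order.TotalTheory.arg_maxP _ _ _ finset.set0 (mem G) (fun A : {set E} => \sum_(e in A) x e) G0).
  by move=> A AG hA; exists A.
have Am : A \in maximizers x.
  by rewrite inE AG; apply/forall_inP.
rewrite /optimal_set; case: pickP => [C /= |/(_ A)]; last by rewrite Am.
rewrite inE => /andP[CG /forall_inP hC]; apply/eqP; rewrite eq_le; apply/andP; split.
  apply/bigmax_leP; split=> //.
  (* The default 0 of the maximum is matched by the empty set, a competitor of value 0. *)
  by have := hC _ G0; rewrite big_set0.
exact: (bigmax_sup C).
Qed.

Lemma measurable_optimal_set (Q : {set E} -> bool) :
  measurable [set x : g_sigma_algebraType (@boxes R E) | Q (optimal_set x)].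
Proof.
apply: (@measurable_finset _ (g_sigma_algebraType (@boxes R E)) _ maximizers
  (fun M : {set {set E}} => Q (odflt finset.set0 [pick A in M]))) => B.
  have [BG|BG] := boolP (B \in G); last first.
    rewrite (_ : [set x | _] = set0) //; apply/seteqP; split=> x //=.
    by rewrite inE (negPf BG).
  rewrite (_ : [set x | _] = \bigcap_(C in [set C | C \in G])
     [set x : g_sigma_algebraType (@boxes R E) | (\sum_(e in C) x e <= \sum_(e in B) x e) = true]).
    apply: fin_bigcap_measurable => [|C _]; first exact: finite_finset.
    have msum (S : {set E}) : measurable_fun setT
        (fun x : g_sigma_algebraType (@boxes R E) => \sum_(e in S) x e).
      rewrite (_ : (fun x => _) = fun x : g_sigma_algebraType (@boxes R E) =>
        \sum_(e <- index_enum E) (if e \in S then x e else 0)); last first.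
        by apply/funext => x; rewrite big_mkcond.
      apply: measurable_sum => e; case: (e \in S); first exact: measurable_proj.
      exact: measurable_cst.
    have := @measurable_fun_ler _ _ _ _ _ _ (msum C) (msum B) measurableT [set true] I.
    by rewrite setTI.
  apply/seteqP; split=> x /=; rewrite inE BG /=.
    by move=> /forall_inP h C CG; apply: h.
  by move=> h; apply/forall_inP => C CG; apply: h.
Qed.

End OptimalSet.

(** * Expected reward *)

Section MeasurableExecution.
Variables (R : realType) (E : finType) (N : {set {set E}}) (l : E -> nat).
Variables (act : E -> R -> bool).
Hypothesis mact : forall e, measurable [set y | act e y].
Variables (d : measure_display) (Om : measurableType d) (P : probability Om R).
Variables (v : E -> {RV P >-> R}) (adv : adversary R E).
Hypothesis madv : forall h e, measurable [set w | adv (v^~ w) h = e].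

Local Notation alg := (level_alg N l act).

(** Once the past is fixed, the next step depends only on the adversary's choice and on whether the
    arriving value is active; both are measurable events. *)
Lemma measurable_execution n h :
  measurable [set w | execution (alg := alg) adv (v^~ w) tt n = h].
Proof.
elim: n h => [|n IH] h.
  have [->|h0] := eqVneq h [::].
    by rewrite (_ : [set w | _] = setT) //; apply/seteqP; split.
  rewrite (_ : [set w | _] = set0) //; apply/seteqP; split=> w //= h1.
  by rewrite -h1 in h0.
case/lastP: h => [|h [e b]].
  rewrite (_ : [set w | _] = set0) //; apply/seteqP; split=> w //; rewrite /mkset level_executionS.
  by move=> /(congr1 size); rewrite size_rcons.
rewrite (_ : [set w | _] = [set w | execution (alg := alg) adv (v^~ w) tt n = h] `&`
  ([set w | adv (v^~ w) h = e] `&`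
   [set w | (act e (v e w) && ~~ level_span N l (taken h) e) = b])).
  apply: measurableI => //; apply: measurableI => //.
  apply: measurable_boolfun; have [sp|nsp] := boolP (level_span N l (taken h) e).
    rewrite (_ : [set w | _] = set0) //; apply/seteqP; split=> w //=; by rewrite andbF.
  rewrite (_ : [set w | _] = v e @^-1` [set y | act e y]); first exact: measurable_preim.
  by apply/seteqP; split=> w /=; rewrite andbT.
apply/seteqP; split=> w; rewrite /mkset level_executionS.
  by move=> /rcons_inj[eh]; rewrite eh => ea; rewrite ea => eb.
by move=> /= [-> [-> ->]].
Qed.

Lemma measurable_accepted e :
  measurable [set w | e \in accepted (alg := alg) adv (v^~ w) tt].
Proof.
rewrite (_ : [set w | _] = \bigcup_(h : seq (E * bool))
  (if (e, true) \in h then [set w | execution (alg := alg) adv (v^~ w) tt #|E| = h] else set0)).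
  apply: (countable_bigcupT_measurable (countableP _)) => h.
  by case: ifP => // _; exact: measurable_execution.
apply/seteqP; split=> w; rewrite /mkset inE.
  by move=> h; exists (execution (alg := alg) adv (v^~ w) tt #|E|) => //; rewrite h.
by move=> [h _]; case: ifP => // eh hw; rewrite -hw in eh.
Qed.

End MeasurableExecution.

(** * Derandomization of the thresholds *)

Section Derandomize.
Variables (R : realType) (E : finType) (D : E -> probability R R).
Variables (hi eq : E -> R -> bool) (sel : E -> {set E} -> bool).
Hypothesis thr : forall e, threshold (hi e) (eq e).
Hypothesis sel_setU1 : forall e S, sel e (e |: S)%SET = sel e S.

Definition accept_prob (a : E -> R) e : R := threshold_prob (D e) (hi e) (eq e) (a e).

(** A product for each [e], because its selection depends only on the activity of the other
    elements. *)
Definition expected_reward (a : E -> R) : \bar R :=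
  (\sum_e threshold_reward (D e) (hi e) (eq e) (a e) *
    (Ex (accept_prob a) (enum E) (fun S => (sel e S)%:R) finset.set0)%:E)%E.

Lemma accept_prob_prob a : (forall e, 0 <= a e <= 1) -> prob (accept_prob a).
Proof.
move=> a01 e; have /andP[a0 a1] := a01 e; have [mh me _ dis] := thr e.
rewrite /accept_prob /threshold_prob; apply/andP; split.
  by rewrite addr_ge0 ?mulr_ge0 ?fine_ge0.
apply: (@le_trans _ _ (fine (D e [set y | hi e y]) + fine (D e [set y | eq e y]))).
  by rewrite lerD2l ler_piMl // fine_ge0.
rewrite -lee_fin EFinD !fineK ?fin_num_measure // -measureU //.
  by apply: probability_le1; exact: measurableU.
by apply/seteqP; split=> // y [/= /dis/negP].
Qed.

(** Along the bias of [f] the sum is affine: in the term of [f] only the reward varies, as selection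
    ignores [f] itself, and in any other term only the selection probability varies, by
    [Ex_affine]. *)
Lemma expected_reward_vertex a : (forall e, 0 <= a e <= 1) ->
  exists cc : E -> bool, (expected_reward a <= expected_reward (fun e => (cc e)%:R%R))%E.
Proof.
move=> a01; apply: affine_vertex => // {a01}a f a01.
set a0 := fun e => if e == f then _ else _.
set a1 := fun e => if e == f then _ else _.
have a001 e : 0 <= a0 e <= 1 by rewrite /a0; case: ifP => // _; rewrite lexx ler01.
have a101 e : 0 <= a1 e <= 1 by rewrite /a1; case: ifP => // _; rewrite lexx ler01.
pose t := a f; have /andP[t0 t1] : 0 <= t <= 1 by exact: a01.
have t1' : 0 <= 1 - t by rewrite subr_ge0.
have aff : (expected_reward a = (1 - t)%:E * expected_reward a0 + t%:E * expected_reward a1)%E.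
  have pos (x : E -> R) e : (forall e, 0 <= x e <= 1) ->
    (0 <= threshold_reward (D e) (hi e) (eq e) (x e) *
      (Ex (accept_prob x) (enum E) (fun S => (sel e S)%:R) finset.set0)%:E)%E.
    move=> x01; apply: mule_ge0.
      by apply: threshold_reward_ge0 => //; have /andP[] := x01 e.
    by rewrite lee_fin; apply: Ex_ge0 => //; exact: accept_prob_prob.
  rewrite /expected_reward !ge0_sume_distrr; [|by move=> e _; apply: pos..].
  rewrite -big_split; apply: eq_bigr => e _ /=.
  have [->|ef] := eqVneq e f.
    have Exf (x : E -> R) : (forall e, e != f -> x e = a e) ->
      Ex (accept_prob x) (enum E) (fun S => (sel f S)%:R) finset.set0 =
      Ex (accept_prob a) (enum E) (fun S => (sel f S)%:R) finset.set0.
      move=> xa; have inv S : (sel f (f |: S)%SET)%:R = (sel f S)%:R :> R by rewrite sel_setU1.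
      rewrite (Ex_filter (accept_prob x) _ _ inv) (Ex_filter (accept_prob a) _ _ inv); apply: eq_Ex => // g.
      by rewrite mem_filter => /andP[/= gf _]; rewrite /accept_prob xa.
    rewrite (Exf a0) ?(Exf a1); try by move=> g gf; rewrite /a0 /a1 (negPf gf).
    rewrite {1}(_ : a f = (1 - t) * a0 f + t * a1 f); last first.
      by rewrite /a0 /a1 eqxx /t; ring.
    rewrite threshold_reward_affine //; last 3 first.
    - by rewrite t0.
    - by have /andP[] := a001 f.
    - by have /andP[] := a101 f.
    rewrite ge0_muleDl ?muleA // mule_ge0 ?lee_fin // threshold_reward_ge0 //.
      by have /andP[] := a001 f.
    by have /andP[] := a101 f.
  have a0e : a0 e = a e by rewrite /a0 (negPf ef).
  have a1e : a1 e = a e by rewrite /a1 (negPf ef).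
  rewrite a0e a1e.
  rewrite (@Ex_affine _ _ _ (accept_prob a0) (accept_prob a1) _ _ _ f t) ?enum_uniq //; last 2 first.
  - by move=> g gf; rewrite /accept_prob /a0 /a1 (negPf gf).
  - by rewrite /accept_prob /threshold_prob /a0 /a1 eqxx -/t; ring.
  rewrite EFinD ge0_muleDr; last 2 first.
  - by rewrite lee_fin mulr_ge0 //; apply: Ex_ge0 => //; exact: accept_prob_prob.
  - by rewrite lee_fin mulr_ge0 //; apply: Ex_ge0 => //; exact: accept_prob_prob.
  by rewrite !EFinM; congr (_ + _)%E; rewrite muleCA.
have pos (x : E -> R) : (forall e, 0 <= x e <= 1) -> (0 <= expected_reward x)%E.
  move=> x01; apply: sume_ge0 => e _; apply: mule_ge0.
    by apply: threshold_reward_ge0 => //; have /andP[] := x01 e.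
  by rewrite lee_fin; apply: Ex_ge0 => //; exact: accept_prob_prob.
have mix y : (0 <= y)%E -> ((1 - t)%:E * y + t%:E * y = y)%E.
  by move=> y0; rewrite -ge0_muleDl ?lee_fin // -EFinD subrK mul1e.
have [le|lt] := leP (expected_reward a0) (expected_reward a1); [right|left].
  rewrite aff -[X in (_ <= X)%E]mix ?pos //; apply: leeD => //.
  by apply: lee_wpmul2l; rewrite ?lee_fin.
rewrite aff -[X in (_ <= X)%E]mix ?pos //; apply: leeD => //.
by apply: lee_wpmul2l; rewrite ?lee_fin // ltW.
Qed.

End Derandomize.

(** * Competitive ratio with free parameters *)

Section Core.
Variables (R : realType) (E : finType) (F : {set {set E}}) (D : E -> probability R R).
Hypothesis mF : is_matroid F.
Variables (k k' : nat) (b c u delta : R).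
Hypotheses (k'0 : (0 < k')%N) (k'k : (k' <= k)%N) (c01 : 0 <= c <= 1)
  (ck : c * k%:R < b * k'%:R) (b1 : b < 1) (u01 : 0 < u <= 1)
  (delta01 : 0 <= delta <= 1) (hdelta : u ^+ (k - k').+1 <= delta * (1 - b)).

Local Notation G := (kfold_union F k).
Let mG : is_matroid G := kfold_union_matroid mF k.
Let G0 : finset.set0 \in G. Proof. by case: mG. Qed.

Definition realizes (d : measure_display) (Om : measurableType d) (P : probability Om R)
    (v : E -> {RV P >-> R}) :=
  mutually_independent v /\
  forall e (B : set R), measurable B -> distribution P (v e) B = D e B.

Definition opt_event (d : measure_display) (Om : measurableType d) (P : probability Om R)
    (v : E -> {RV P >-> R}) e := [set w | e \in optimal_set G (v^~ w)].

Lemma measurable_opt_event (d : measure_display) (Om : measurableType d) (P : probability Om R)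
    (v : E -> {RV P >-> R}) e : measurable (opt_event v e).
Proof.
have := measurable_vector v measurableT (measurable_optimal_set G (fun A => e \in A)).
by rewrite setTI.
Qed.

Lemma opt_event_prob (d d' : measure_display) (Om : measurableType d) (Om' : measurableType d')
    (P : probability Om R) (P' : probability Om' R)
    (v : E -> {RV P >-> R}) (v' : E -> {RV P' >-> R}) e :
  realizes v -> realizes v' -> P (opt_event v e) = P' (opt_event v' e).
Proof.
move=> [vi vD] [vi' vD'].
apply: (joint_law_unique vi vi' _ (measurable_optimal_set G (fun A => e \in A))).
by move=> f B mB; rewrite vD // vD'.
Qed.

(** The optimum meets [T] in an independent set, hence in at most rank many elements; then
    expectations are taken. *)
Lemma opt_event_rank (d : measure_display) (Om : measurableType d) (P : probability Om R)
    (v : E -> {RV P >-> R}) (T : {set E}) :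
  \sum_(e in T) fine (P (opt_event v e)) <= (rank G T)%:R.
Proof.
have mo := measurable_opt_event v.
rewrite -lee_fin -sumEFin.
rewrite (eq_bigr (fun e => \int[P]_w ((e \in optimal_set G (v^~ w))%:R)%:E)%E); last first.
  move=> e _; rewrite integral_bool; [by rewrite fineK // fin_num_measure | exact: mo].
rewrite -big_enum -ge0_integral_sum //; last first.
  by move=> e; apply/measurable_EFinP; apply: measurable_bool_real; exact: mo.
apply: (@le_trans _ _ (\int[P]_w (cst ((rank G T)%:R)%:E w))%E); last first.
  rewrite integral_cst // -[X in (_ <= X)%E]mule1; apply: lee_wpmul2l; rewrite ?lee_fin //.
  exact: probability_le1.
apply: ge0_le_integral => //.
- by move=> w _; apply: sume_ge0.
- apply: emeasurable_sum => e; apply/measurable_EFinP.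
  by apply: measurable_bool_real; exact: mo.
- move=> w _; rewrite sumEFin lee_fin big_enum -natr_sum ler_nat.
  apply: (@leq_trans #|T :&: optimal_set G (v^~ w)|); last first.
    apply: indep_rank_ge; last exact: finset.subsetIl.
    by case: mG => _ + _; apply; [exact: finset.subsetIr | exact: optimal_set_in].
  rewrite -sum1_card big_mkcond [X in (_ <= X)%N]big_mkcond; apply: leq_sum => e _.
  by rewrite finset.in_setI; case: (e \in T); case: (e \in optimal_set _ _).
Qed.

Section Run.
Variables (hi eq : E -> R -> bool) (l : E -> nat) (cc : E -> bool).
Hypothesis thr : forall e, threshold (hi e) (eq e).

Definition vertex_act e y := hi e y || (cc e && eq e y).
Definition selectable e (S : {set E}) := ~~ level_span G l (S :\ e)%SET e.

Lemma selectable_setU1 e S : selectable e (e |: S)%SET = selectable e S.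
Proof.
rewrite /selectable; congr (~~ level_span _ _ _ _); apply/setP => f.
by rewrite !inE; case: eqVneq.
Qed.

Lemma measurable_vertex_act e : measurable [set y | vertex_act e y].
Proof.
have [mh me _ _] := thr e.
rewrite (_ : [set y | _] = [set y | hi e y] `|` (if cc e then [set y | eq e y] else set0)).
  by apply: measurableU => //; case: ifP.
apply/seteqP; split=> y; rewrite /mkset /vertex_act; case: (cc e) => /=.
- by move=> /orP[]; [left|right].
- by rewrite orbF; left.
- by case=> ->; rewrite ?orbT.
- by case=> // ->.
Qed.

Lemma vertex_act_natr e y : (vertex_act e y)%:R = (hi e y)%:R + (cc e)%:R * (eq e y)%:R :> R.
Proof.
have [_ _ _ dis] := thr e; have := dis y; rewrite /vertex_act.
case: (hi e y); case: (eq e y); case: (cc e) => //= h; rewrite ?mulr0 ?mul0r ?mulr1 ?addr0 ?add0r //.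
by have := h isT.
Qed.

Variables (d : measure_display) (Om : measurableType d) (P : probability Om R).
Variables (v : E -> {RV P >-> R}) (adv : adversary R E).
Hypothesis rv : realizes v.
Hypothesis ladv : legal_adversary adv.
Hypothesis madv : forall h e, measurable [set w | adv (v^~ w) h = e].

Local Notation alg := (level_alg G l vertex_act).

Lemma accept_probE e :
  fine (P (v e @^-1` [set y | vertex_act e y])) =
  accept_prob D hi eq (fun e => (cc e)%:R) e.
Proof.
have [_ vD] := rv; have [mh me _ dis] := thr e.
have -> : P (v e @^-1` [set y | vertex_act e y]) = D e [set y | vertex_act e y].
  by rewrite -vD //; exact: measurable_vertex_act.
rewrite /accept_prob /threshold_prob; case: (boolP (cc e)) => ce; last first.
  rewrite mul0r addr0; congr (fine (D e _)); apply/seteqP.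
  by split=> y; rewrite /mkset /vertex_act (negPf ce) /= orbF.
rewrite mul1r -fineD ?fin_num_measure // -measureU //; last first.
  by apply/seteqP; split=> // y [/= /dis/negP].
congr (fine (D e _)); apply/seteqP; split=> y; rewrite /mkset /vertex_act ce /=.
  by move=> /orP[]; [left|right].
by case=> ->; rewrite ?orbT.
Qed.

Lemma alg_measurable e : measurable
  [set ws : Om * seed alg | e \in accepted adv (v^~ ws.1) ws.2].
Proof.
have := @measurable_fst _ _ Om unit measurableT _
  (measurable_accepted G l measurable_vertex_act madv e).
by rewrite setTI.
Qed.

Let reward w : R :=
  \sum_e v e w * (vertex_act e (v e w))%:R * (selectable e (active vertex_act (v^~ w)))%:R.

Lemma act_reward_ge0 e y : 0 <= y * (vertex_act e y)%:R.
Proof. by rewrite vertex_act_natr threshold_ge0. Qed.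

Lemma measurable_act_reward e : measurable_fun setT (fun y : R => y * (vertex_act e y)%:R).
Proof.
by apply: measurable_funM => //; apply: measurable_bool_real; exact: measurable_vertex_act.
Qed.

Lemma measurable_selected e : measurable_fun setT (fun w =>
  v e w * (vertex_act e (v e w))%:R * (selectable e (active vertex_act (v^~ w)))%:R).
Proof.
apply: measurable_funM.
  by apply: (measurableT_comp (measurable_act_reward e)); exact: measurable_funP.
by apply: measurable_bool_real; apply: measurable_active; exact: measurable_vertex_act.
Qed.

Lemma integral_reward :
  (\int[P]_w (reward w)%:E = expected_reward D hi eq selectable (fun e => (cc e)%:R%R))%E.
Proof.
have [vi vD] := rv.
under eq_integral do rewrite /reward -sumEFin.
rewrite ge0_integral_sum //; last 2 first.
- by move=> e; apply/measurable_EFinP; exact: measurable_selected.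
- by move=> e w _; rewrite lee_fin mulr_ge0 // act_reward_ge0.
apply: eq_bigr => e _.
rewrite (integral_selection vi measurable_vertex_act (measurable_act_reward e)
  (act_reward_ge0 e) (selectable_setU1 e)).
congr (_ * _%:E)%E; last by apply: eq_Ex => // f _; exact: accept_probE.
rewrite /threshold_reward (@eq_measure_integral _ _ _ _ (D e)); last by move=> A mA _; exact: vD.
by apply: eq_integral => y _; rewrite vertex_act_natr.
Qed.

(** All active selectable elements are accepted, and any further accepted element is active too, so
    its value is nonnegative. *)
Lemma alg_reward :
  (expected_reward D hi eq selectable (fun e => (cc e)%:R%R) <=
   'E_(P \x seed_law alg)[fun ws =>
        (\sum_(e in accepted adv (v^~ ws.1) ws.2) v e ws.1)%R])%E.
Proof.
rewrite -integral_reward unlock.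
have mreward : measurable_fun setT reward by apply: measurable_sum => e; exact: measurable_selected.
have reward0 w : 0 <= reward w.
  by apply: sumr_ge0 => e _; rewrite mulr_ge0 // act_reward_ge0.
have mfst : measurable_fun setT (fun ws : Om * unit => (reward ws.1)%:E).
  by apply/measurable_EFinP; apply: (measurableT_comp mreward); exact: measurable_fst.
have -> : (\int[P]_w (reward w)%:E =
   \int[P \x seed_law alg]_ws (reward ws.1)%:E)%E.
  rewrite (@fubini_tonelli1 _ _ _ _ _ P (seed_law alg)) //; last by move=> ws; rewrite lee_fin.
  apply: eq_integral => w _; rewrite /fubini_F /=.
  by rewrite integral_cst //= diracE in_setT mule1.
apply: ge0_le_integral => //.
- by move=> ws _; rewrite lee_fin.
- apply/measurable_EFinP.
  rewrite (_ : (fun ws => _) = fun ws : Om * unit => \sum_e v e ws.1 *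
     (e \in accepted (alg := alg) adv (v^~ ws.1) ws.2)%:R); last first.
    apply/funext => ws; rewrite big_mkcond; apply: eq_bigr => e _.
    by case: ifP; rewrite ?mulr1 ?mulr0.
  apply: measurable_sum => e; apply: measurable_funM.
    by apply: measurableT_comp; [exact: measurable_funP | exact: measurable_fst].
  by apply: measurable_bool_real; exact: alg_measurable.
move=> [w s] _; rewrite lee_fin /reward /= [X in _ <= X]big_mkcond; apply: ler_sum => e _.
have [ae|ae] := boolP (vertex_act e (v e w)); last first.
  rewrite mulr0 mul0r; case: ifP => //; rewrite inE => ea.
  have /fintype.subsetP/(_ e) := @taken_active R E G l vertex_act adv (v^~ w) s #|E|.
  by rewrite !inE => /(_ ea); rewrite (negPf ae).
have ve : 0 <= v e w by have := act_reward_ge0 e (v e w); rewrite ae mulr1.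
rewrite mulr1; have [se|se] := boolP (selectable _ _); last first.
  by rewrite mulr0; case: ifP.
by rewrite mulr1 (selected_accepted mG _ ladv ae se).
Qed.

End Run.

(** The ranks in the two unions differ by a factor of at most k/k', which [c * k < b * k'] absorbs.
    Strictness needs a positive rank, hence a non-loop in [T]. *)
Lemma sumr_opt_lt (T : {set E}) (X : E -> R) : T != finset.set0 ->
  (forall e, e \in T -> [set e]%SET \in F) ->
  \sum_(e in T) X e <= (rank G T)%:R ->
  \sum_(e in T) c * X e < b * (rank (kfold_union F k') T)%:R.
Proof.
move=> T0 TF hX; set r' := rank _ T.
have r0 : (0 < r')%N.
  have /set0Pn[e eT] := T0; rewrite -(cards1 e).
  apply: indep_rank_ge; last by rewrite finset.sub1set.
  have e1 : [set e]%SET \in kfold_union F 1.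
    have := kfold_unionU mF (j := 0) (A := finset.set0) _ (TF e eT).
    by rewrite finset.set0U; apply; case: (kfold_union_matroid mF 0).
  elim: k' k'0 => // n IH _; have [->//|n0] := posnP n.
  have := kfold_unionU mF (IH n0) (TF e eT); by rewrite finset.setUid.
rewrite -mulr_sumr -(ltr_pM2l (_ : 0 < k'%:R)) ?ltr0n // mulrCA.
have h : k'%:R * (rank G T)%:R <= k%:R * r'%:R :> R.
  by rewrite -!natrM ler_nat; exact: rank_kfold_le.
have /andP[c0 c1] := c01.
apply: (@le_lt_trans _ _ (c * (k%:R * r'%:R))).
  by apply: ler_wpM2l => //; apply: le_trans h; apply: ler_wpM2l.
by rewrite mulrA [X in _ < X]mulrA [k'%:R * b]mulrC ltr_pM2r // ltr0n.
Qed.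

Lemma loop_not_optimal (x : E -> R) e : [set e]%SET \notin F -> e \notin optimal_set G x.
Proof.
apply: contra => eo.
have /(kfold_unionP mF)[cl [_ clF]] := optimal_set_in G0 x.
case: mF => _ + _; apply; last exact: (clF (cl e)).
by rewrite finset.sub1set inE eo eqxx.
Qed.

(** The shares [X] are scaled by [c] to reach density [p], where [b] bounds the spanning
    probability, and then by [u] to the acceptance density; at that density a non-loop is spanned
    with probability at most [delta]. Each element thus keeps a fraction [(1 - delta) * (u * c)] of
    its share. *)
Theorem kfold_union_competitive : exists alg, competitive G D ((1 - delta) * (u * c)) alg.
Proof.
have /andP[c0 c1] := c01; have /andP[u0 u1] := u01; have /andP[de0 de1] := delta01.
(* Without a realization of [D] there is nothing to prove; with one, [X] does
   not depend on which one is used. *)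
have [[d0 [Om0 [P0 [v0 rv0]]]]|no] := pselect (exists (d : measure_display)
    (Om : measurableType d) (P : probability Om R) (v : E -> {RV P >-> R}), realizes v); last first.
  exists (level_alg G (fun=> 0%N) (fun _ _ => false)); split; first exact: level_alg_feasible.
  by move=> d Om P v adv vi vD; case: no; exists d, Om, P, v.
pose X e := fine (P0 (opt_event v0 e)).
have X01 e : 0 <= X e <= 1.
  rewrite /X fine_ge0 //= -lee_fin fineK ?probability_le1 ?fin_num_measure //;
  exact: measurable_opt_event.
have Xrv (d : measure_display) (Om : measurableType d) (P : probability Om R)
    (v : E -> {RV P >-> R}) e : realizes v -> fine (P (opt_event v e)) = X e.
  by move=> rv; rewrite (opt_event_prob e rv rv0).
(* The triple packs [hi], [eq] and the bias, so that one use of choice provides them for all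
   elements. *)
pose spec e (z : (R -> bool) * (R -> bool) * R) :=
  [/\ threshold z.1.1 z.1.2, 0 <= z.2 <= 1, threshold_prob (D e) z.1.1 z.1.2 z.2 <= u * c * X e &
    forall (d : measure_display) (Om : measurableType d) (P : probability Om R)
      (v : E -> {RV P >-> R}), realizes v ->
      ((u * c)%:E * \int[P]_w (Num.max (v e w) 0 * \1_(opt_event v e) w)%:E <=
        threshold_reward (D e) z.1.1 z.1.2 z.2)%E].
have /choice[z hz] : forall e, exists z, spec e z.
  move=> e; have /andP[x0 x1] := X01 e.
  have ucX : 0 <= u * c * X e by rewrite !mulr_ge0 // ltW.
  have [hi [eq [be [thr be01 hq hex]]]] := threshold_exists (D e) ucX.
  exists (hi, eq, be); split=> // d Om P v rv; apply: hex.
  - by move=> B mB; apply: (proj2 rv).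
  - exact: measurable_opt_event.
  - by apply/andP; split; [apply: mulr_ge0 | apply: mulr_ile1] => //; apply: ltW.
  - by rewrite (Xrv _ _ _ _ _ rv).
pose hi e := (z e).1.1; pose eq e := (z e).1.2; pose be e := (z e).2.
have thr e : threshold (hi e) (eq e) by have [] := hz e.
have be01 e : 0 <= be e <= 1 by have [] := hz e.
pose p e := c * X e; pose q := accept_prob D hi eq be.
have hp : prob p.
  by move=> e; have /andP[x0 x1] := X01 e; rewrite mulr_ge0 //= mulr_ile1.
have hq e : 0 <= q e <= u * p e.
  have /andP[-> _] := accept_prob_prob D thr be01 e.
  by have [_ _ h _] := hz e; rewrite /p mulrA.
have hT (T : {set E}) : T != finset.set0 -> (forall e, e \in T -> [set e]%SET \in F) ->
  \sum_(e in T) p e < b * (rank (kfold_union F k') T)%:R.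
  by move=> T0 TF; apply: sumr_opt_lt => //; exact: opt_event_rank.
have [l hl] := levels_exist mF k'0 k'k u01 hp hq hT.
have sel_ge e : [set e]%SET \in F ->
    1 - delta <= Ex q (enum E) (fun S => (selectable l e S)%:R) finset.set0.
  move=> eF; have h := hl e eF.
  have -> : Ex q (enum E) (fun S => (selectable l e S)%:R) finset.set0 = 
     1 - Ex q (enum E) (fun B => (level_span G l (B :\ e)%SET e)%:R) finset.set0.
    transitivity (Ex q (enum E) (fun B => 1 - (level_span G l (B :\ e)%SET e)%:R) finset.set0).
      apply: eq_Ex => // B; rewrite /selectable.
      by case: (level_span _ _ _ _); rewrite ?subr0 ?subrr.
    by rewrite ExB Ex_cst.
  rewrite lerD2l lerN2 -(ler_pM2l (_ : 0 < 1 - b)) ?subr_gt0 //.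
  by apply: le_trans h _; apply: le_trans hdelta _; rewrite mulrC.
have [cc hcc] := expected_reward_vertex D thr (selectable_setU1 l) be01.
exists (level_alg G l (vertex_act hi eq cc)); split; first exact: level_alg_feasible.
move=> d Om P v adv vi vD ladv madv; have rv : realizes v by [].
split; first by move=> e; exact: alg_measurable.
have := alg_reward l cc thr rv ladv madv; apply: le_trans.
apply: le_trans hcc.
pose pos e w := Num.max (v e w) 0 * \1_(opt_event v e) w.
have pos0 e w : 0 <= pos e w by rewrite mulr_ge0 // le_max lexx orbT.
have mpos e : measurable_fun setT (pos e) by apply: measurable_pos; exact: measurable_opt_event.
have hopt : ('E_P[fun w => offline_optimum G (v^~ w)] <= \sum_e \int[P]_w (pos e w)%:E)%E.
  rewrite unlock -ge0_integral_sum //; last 2 first.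
  - by move=> e; apply/measurable_EFinP.
  - by move=> e w _; rewrite lee_fin.
  apply: ge0_le_integral => //.
  - by move=> w _; rewrite lee_fin; exact: offline_optimum_ge0.
  - apply/measurable_EFinP.
    rewrite (_ : (fun w => _) = fun w => \sum_e v e w * (e \in optimal_set G (v^~ w))%:R); last first.
      apply/funext => w; rewrite offline_optimum_set // big_mkcond.
      by apply: eq_bigr => e _; case: ifP; rewrite ?mulr1 ?mulr0.
    apply: measurable_sum => e; apply: measurable_funM; first exact: measurable_funP.
    by apply: measurable_bool_real; exact: (measurable_opt_event v e).
  - by apply: emeasurable_sum => e; apply/measurable_EFinP.
  - move=> w _; rewrite sumEFin lee_fin offline_optimum_set // big_mkcond.
    apply: ler_sum => e _; rewrite /pos indicE; case: ifP => eo.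
      by rewrite mem_set // mulr1 le_max lexx.
    by rewrite memNset ?mulr0 //= => h; rewrite /opt_event /= eo in h.
have coef0 : (0 <= ((1 - delta) * (u * c))%:E)%E.
  by rewrite lee_fin !mulr_ge0 ?subr_ge0 // ltW.
apply: le_trans (lee_wpmul2l coef0 hopt) _.
rewrite ge0_sume_distrr; last by move=> e _; apply: integral_ge0 => w _; rewrite lee_fin.
apply: lee_sum => e _; have [_ _ _ hex] := hz e.
have rew0 : (0 <= threshold_reward (D e) (hi e) (eq e) (be e))%E.
  by apply: threshold_reward_ge0 => //; have /andP[] := be01 e.
(* Levels give no guarantee for loops, but a loop is never optimal and its share is 0. *)
have [eF|eF] := boolP ([set e]%SET \in F).
  rewrite EFinM -muleA muleC; apply: lee_pmul.
  - apply: mule_ge0; first by rewrite lee_fin mulr_ge0 // ltW.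
    by apply: integral_ge0 => w _; rewrite lee_fin.
  - by rewrite lee_fin subr_ge0.
  - exact: hex.
  - by rewrite lee_fin; exact: sel_ge.
rewrite [X in (_ * X)%E]integral0_eq ?mule0; last first.
  move=> w _; rewrite /pos indicE memNset ?mulr0 //= /opt_event /=.
  by apply/negP; exact: loop_not_optimal.
apply: mule_ge0 => //; rewrite lee_fin; apply: Ex_ge0 => //.
exact: accept_prob_prob.
Qed.

End Core.

(** * The rate *)

Section Loss.
Variable R : realType.

Definition log_rate (k : nat) : R := Num.sqrt (ln (k%:R : R) / k%:R).

(** With [e = log_rate k], the ratio [(1 - e) ^+ 4] is [(1 - delta) * (u * c)] for [delta = e],
    [u = 1 - e] and [c = (1 - e) ^+ 2]. Loss 1 covers the [k] where these choices are not made. *)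
Definition loss (k : nat) : R :=
  if (1 <= ln (k%:R : R)) && (log_rate k < 1) then 1 - (1 - log_rate k) ^+ 4 else 1.

Lemma loss01 k : 0 <= loss k <= 1.
Proof.
rewrite /loss; case: ifP => [/andP[_ e1]|_]; last by rewrite lexx ler01.
have e0 : 0 <= log_rate k by apply: sqrtr_ge0.
by rewrite subr_ge0 exprn_ile1 ?subr_ge0 ?(ltW e1) //= ?gerBl ?exprn_ge0 ?subr_ge0 ?(ltW e1).
Qed.

Lemma loss_bigO : loss =O_\oo (fun k : nat => Num.sqrt (ln (k%:R : R) / k%:R)).
Proof.
(* The constant 4 comes from [1 - (1 - e) ^+ 4 <= 4 * e]; [ln n >= 1] as soon as [n] exceeds
   [expR 1]. *)
apply/eqOP; exists 4; split=> // C C4.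
exists (Num.truncn (expR 1 : R)).+1 => // n /= hn.
have ln1 : 1 <= ln (n%:R : R).
  have e_n : expR 1 <= n%:R :> R.
    apply: ltW; by apply: lt_le_trans (truncnS_gt _) _; rewrite ler_nat.
  by rewrite -[X in X <= _]expRK ler_ln ?posrE ?expR_gt0 // (lt_le_trans (expR_gt0 1)).
have e0 : 0 <= log_rate n by apply: sqrtr_ge0.
rewrite -/(log_rate n) (ger0_norm e0) ger0_norm; last by have /andP[] := loss01 n.
apply: (@le_trans _ _ (4 * log_rate n)); last by rewrite ler_wpM2r // ltW.
rewrite /loss ln1 /=; case: ltP => [e1|]; last by lra.
by move: e0 e1; set e := log_rate n => e0 e1; nra.
Qed.

Lemma loss_competitive (k : nat) (E : finType) (F : {set {set E}}) (D : E -> probability R R) :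
  (1 <= k)%N -> is_matroid F ->
  exists alg : online_algorithm R E, competitive (kfold_union F k) D (1 - loss k) alg.
Proof.
move=> k1 mF; rewrite /loss; case: ifP => [/andP[ln1 e1]|_]; last first.
  (* Only ratio 0 is claimed here, obtained from [c = 0] and [delta = 1]. *)
  have [||||||alg halg] := @kfold_union_competitive R E F D mF k k (1/2) 0 (1/2) 1 k1 (leqnn k).
  - by rewrite lexx ler01.
  - by rewrite mul0r mulr_gt0 ?divr_gt0 // ltr0n.
  - by lra.
  - by lra.
  - by rewrite lexx ler01.
  - by rewrite subnn expr1; lra.
  by exists alg; move: halg; rewrite subrr mul0r.
set e := log_rate k in e1 *.
have k0 : 0 < k%:R :> R by rewrite ltr0n.
have e2 : e ^+ 2 = ln (k%:R : R) / k%:R.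
  by rewrite /e /log_rate sqr_sqrtr // divr_ge0 // (le_trans ler01).
have e2k : k%:R^-1 <= e ^+ 2 by rewrite e2 -[X in X <= _]mul1r ler_wpM2r // invr_ge0 ltW.
have ep : 0 < e.
  rewrite lt_neqAle sqrtr_ge0 andbT; apply: contraTneq e2k => <-.
  by rewrite expr0n /= -ltNge invr_gt0.
pose x := (1 - e) * k%:R : R.
have x0 : 0 <= x by rewrite mulr_ge0 ?subr_ge0 ?(ltW e1) // ltW.
(* The least integer strictly above [(1 - e) * k]: strictness gives [c * k < b * k'] for
   [b = 1 - e]. *)
pose k' := (Num.truncn x).+1.
have k'x : k'%:R <= x + 1 by rewrite /k' -natr1 lerD2r truncn_le.
have xk' : x < k'%:R by exact: truncnS_gt.
have k'k : (k' <= k)%N.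
  rewrite -(ltr_nat R); apply: le_lt_trans (_ : x < _); first by rewrite truncn_le.
  by rewrite /x gtr_pMl //; lra.
have [||||||alg halg] := @kfold_union_competitive R E F D mF k k' (1 - e) ((1 - e) ^+ 2) (1 - e) e isT k'k.
- by rewrite exprn_ge0 ?exprn_ile1 //; lra.
- by rewrite expr2 -mulrA ltr_pM2l //; lra.
- by lra.
- by lra.
- by lra.
(* The exponent is at least [e * k], so the power is at most exp(- e^2 k) = 1/k by the choice of
   [e], and 1/k is at most [e ^+ 2], which is [delta * (1 - b)], because [ln k >= 1]. *)
- apply: (@le_trans _ _ k%:R^-1); last by rewrite opprB addrC subrK -expr2.
  apply: (@le_trans _ _ (expR (- e) ^+ (k - k').+1)).
    by apply: lerXn2r; rewrite ?nnegrE ?expR_ge0 ?expR_ge1Dx // subr_ge0 ltW.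
  rewrite -expRM_natl -(lnK (_ : k%:R \is Num.pos)) ?posrE // -expRN ler_expR.
  have -> : ln k%:R = e ^+ 2 * k%:R by rewrite e2 divfK // gt_eqF.
  have : e * k%:R <= (k - k').+1%:R.
    by rewrite -natr1 natrB //; move: k'x; rewrite /x; lra.
  move=> h; have := ler_wpM2l (ltW ep) h; rewrite expr2; lra.
exists alg; move: halg; congr competitive; ring.
Qed.

End Loss.

Theorem theorem1p2 (R : realType) :
  exists g : nat -> R,
    [/\ forall k : nat, (1 <= k)%N -> 0 <= g k <= 1,
        g =O_\oo (fun k : nat => Num.sqrt (ln (k%:R : R) / k%:R))
      & forall (k : nat) (E : finType) (F : {set {set E}})
          (D : E -> probability R R),
          (1 <= k)%N -> is_matroid F ->
          (forall e : E, D e [set x : R | 0 <= x] = 1%E) ->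
          exists alg : online_algorithm R E,
            competitive (kfold_union F k) D (1 - g k) alg].
Proof.
exists (@loss R); split=> [k _||k E F D k1 mF _].
- exact: loss01.
- exact: loss_bigO.
- exact: loss_competitive.
Qed.
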